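(* Let $b$ and $w$ be positive integers, let $\pi$ be a probability distribution on the non-negative integers with mean $0<\mu\le\infty$, and let $\tau\sim\pi$. Suppose $k$ is an integer such that either (a) $\mathbb{E}\,\tau^p<\infty$ for some $p>1$, and $1\le k<(\frac p2-1)(\mu+1)-1$, or (b) there are constants $\varepsilon>0$ and $C>0$ such that $\mathbb{P}[\tau>n]\ge C n^{-(1-\varepsilon)}$ for all $n$ large enough, and $k\ge 1$. Then there is a positive constant $m_k(b,w,\pi)$ such that, for $X_n\sim\mathcal{P}_n^{\pi}(b,w)$, $$\mathbb{E}\left\{\left(\frac{X_n}{n^{\mu/(\mu+1)}}\right)^k\right\}\to m_k(b,w,\pi)\qquad\text{as } n\to\infty.$$
   Context: Convention: $\frac{\mu}{\mu+1}$ is interpreted as $1$ when $\mu=\infty$. Urn model. Let $\pi=(\pi_k)_{k\ge0}$ be a probability distribution on the non-negative integers with $\pi_0<1$, let $\tau_1,\tau_2,\ldots$ be i.i.d. with law $\pi$, and let $T_j=\sum_{i=1}^j\tau_i$. An urn initially (at step $0$) contains $b$ black and $w$ white balls. At each step $1,2,\ldots$, a ball is drawn uniformly at random from the urn and replaced along with another ball of the same color. Additionally, for every $i\ge1$, after draw number $T_i$, regardless of the outcome of the draw, one extra black ball is added to the urn. If several of the $T_i$ coincide, that many black balls are added after the corresponding draw; for each $i$ with $T_i=0$ a black ball is added before the first draw. The law of the number of white balls in the urn after $n$ steps is denoted $\mathcal{P}_n^{\pi}(b,w)$. *)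

(* Defs.v *)
From HB Require Import structures.
From mathcomp Require Import all_boot all_order all_algebra finmap.
From mathcomp Require Import all_classical all_reals all_analysis.

Set Implicit Arguments.
Unset Strict Implicit.
Unset Printing Implicit Defensive.

Import Order.TTheory GRing.Theory Num.Theory.
Import numFieldNormedType.Exports.

Local Open Scope classical_set_scope.
Local Open Scope ring_scope.

(** Sequences are indexed from 0: [t i] is tau_(i+1), and [c j] is the
    outcome of draw number [j.+1] ([true] when the drawn ball is white). *)

(* T_(i+1) *)
Definition arrival (t : nat -> nat) (i : nat) : nat := (\sum_(j < i.+1) t j)%N.

(* [fset_set] of an infinite set is empty.  Infinitely many arrival times
   coincide only if [t] is eventually 0, which has probability 0 when the
   [t i] are i.i.d. and not almost surely 0. *)
Definition arrivals_at (t : nat -> nat) (n : nat) : nat :=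
  #|` fset_set [set i | arrival t i = n]|%fset.

(* Numbers of (black, white) balls after [n] steps, including the black balls
   added after draw number [n]. *)
Fixpoint urn (b w : nat) (t : nat -> nat) (c : nat -> bool) (n : nat)
    : nat * nat :=
  if n is m.+1 then
    let: (x, y) := urn b w t c m in
    ((x + ~~ c m + arrivals_at t m.+1)%N, (y + c m)%N)
  else ((b + arrivals_at t 0)%N, w).

Definition mutually_independent {R : realType} {d} {Omega : measurableType d}
    (P : probability Omega R) (X : nat -> Omega -> nat) : Prop :=
  forall (J : {fset nat}) (A : nat -> set nat),
    P (\bigcap_(i in [set` J]) (X i @^-1` A i)) =
    (\prod_(i <- J) P (X i @^-1` A i))%E.

(* The sigma-algebra generated by all the [tau i] and the first [n] draws. *)
Definition history {Omega : Type} (tau : nat -> Omega -> nat)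
    (draw : nat -> Omega -> bool) (n : nat) : set (set Omega) :=
  <<s [set A | (exists i k, A = tau i @^-1` [set k]) \/
               (exists2 j, (j < n)%N & A = draw j @^-1` [set true])] >>.

(* [draw_uniform] says that the conditional probability, given
   [history tau draw n], that draw number [n.+1] is white is the proportion of
   white balls in the urn.  Conditioning on the whole sequence [tau] means
   that the addition times are not influenced by the draws. *)
Record urn_process {R : realType} (pi : probability nat R) (b w : nat)
    {d} {Omega : measurableType d} (P : probability Omega R)
    (tau : nat -> {RV P >-> nat}) (draw : nat -> {RV P >-> bool})
    (white : nat -> {RV P >-> nat}) : Prop := UrnProcess {
  tau_law : forall i A, distribution P (tau i) A = pi A ;
  tau_independent : mutually_independent P (fun i => tau i : Omega -> nat) ;
  draw_uniform : forall n A,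
    history (fun i => tau i : Omega -> nat) (fun j => draw j : Omega -> bool)
      n A ->
    P (A `&` draw n @^-1` [set true]) =
    (\int[P]_(o in A)
       (let: (x, y) := urn b w (tau ^~ o) (draw ^~ o) n in
        y%:R / (x + y)%N%:R)%:E)%E ;
  white_count : forall n o, white n o = (urn b w (tau ^~ o) (draw ^~ o) n).2
}.

(* [L] is the law P_n^pi(b, w). *)
Definition is_urn_law {R : realType} (pi : probability nat R) (b w n : nat)
    (L : set nat -> \bar R) : Prop :=
  exists (d : measure_display) (Omega : measurableType d)
    (P : probability Omega R) (tau : nat -> {RV P >-> nat})
    (draw : nat -> {RV P >-> bool}) (white : nat -> {RV P >-> nat}),
    urn_process pi b w tau draw white /\
    forall A, L A = distribution P (white n) A.

Definition mean {R : realType} (pi : probability nat R) : \bar R :=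
  (\int[pi]_t (t%:R)%:E)%E.

(* mu / (mu + 1), read as 1 when mu is infinite. *)
Definition growth_exponent {R : realType} (mu : \bar R) : R :=
  if mu is EFin r then r / (r + 1) else 1.

(* Main.v *)
Require Import Defs.
From HB Require Import structures.
From mathcomp Require Import all_boot all_order all_algebra finmap.
From mathcomp Require Import all_classical all_reals all_analysis.
From mathcomp Require Import measurable_realfun ring lra zify.

Import Order.TTheory GRing.Theory Num.Theory.
Import numFieldNormedType.Exports.

Local Open Scope classical_set_scope.
Local Open Scope ring_scope.

(** Write s = b + w and x^(k) = x (x + 1) ... (x + k - 1).  After i steps the
urn holds N_i = s + i + A_i balls, where A_i is the number of black balls added
so far.  A white draw has conditional probability x / N_i when there are x white
balls, and it multiplies x^(k) by (x + k) / x.  Hence, given the waiting times,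
x^(k) grows on average by the factor 1 + k / N_i, and
[E (X_n)^(k) = w^(k) E G_n], where [G_n = \prod_(i < n) (1 + k / N_i)].
Only the waiting times are left in E G_n.

Let alpha = mu / (mu + 1), beta = k alpha and kappa = k - beta.  By the law of
large numbers A_n is close to n / mu, so that N_n is close to n / alpha and G_n
should grow like n^beta.  The quantitative input, [concentrated], is that
1 / N_n differs from alpha / n by at most C n^(-(1 + delta)) outside an event of
probability at most C n^(-(kappa + delta)).

- Convergence.  The difference E G_(n+1) - (1 + beta / n) E G_n is k times the
  expectation of G_n (1 / N_n - alpha / n).  Outside the exceptional event it is
  a summable relative error.  On that event G_n may be much larger than n^beta,
  but always G_n <= (n + 1)^k, and the probability n^(-kappa) pays exactly for
  the excess n^(k - beta).  So E G_n / n^beta satisfies a recursion with summable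
  relative errors, and converges ([growth_cvg]).
- Positivity.  By Jensen's inequality E G_n >= exp (E log G_n), and
  E log G_n >= beta log n - O(1), again by concentration
  ([growth_lower_bound]).
- Concentration under (a).  Truncating the waiting times at a level L of order
  sqrt n keeps exp (t tau) within a quadratic error of its linear part for
  |t| <= 1 / L.  Chernoff's bound then makes deviations of size n^(3/4)
  superpolynomially unlikely.  Some truncation occurs with probability
  O(n E tau^p / n^(p/2)), which is small enough because
  p / 2 - 1 > (k + 1) / (mu + 1) > kappa ([concentrated_light_tail]).
- Concentration under (b).  Here alpha = 1, kappa = 0, and A_n can exceed h
  only if h + 1 independent waiting times are all at most n; this is unlikely
  as soon as h is a little larger than n^(1 - eps)
  ([concentrated_heavy_tail]).

The number A_i depends on infinitely many waiting times; it is
replaced by the number of additions among the first J ones, and J tends to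
infinity for fixed n ([moment_growth_limit]).  The truncated expectations
depend only on pi, so one reference process serves all probability spaces of the
statement ([Ex_growth_eq_law]).  Finally x^k and x^(k) differ by O(x^(k-1)),
which is negligible after division by n^beta ([power_rising_moment]). *)

(** * Expectation of bounded measurable functions *)

Section BoundedExpectation.
Context {R : realType} {d} {T : measurableType d} (P : probability T R).
Implicit Types f g : T -> R.

Definition bounded_measurable f :=
  measurable_fun setT f /\ exists M, forall x, `|f x| <= M.

Definition Ex f : R := \int[P]_x f x.

Lemma bounded_measurable_integrable f :
  bounded_measurable f -> P.-integrable setT (EFin \o f).
Proof.
move=> [mf [M fM]]; apply: measurable_bounded_integrable => //.
  exact: le_lt_trans (probability_le1 P measurableT) (ltry 1).
by exists M; split; [exact: num_real|move=> y My x _; exact: le_trans (fM x) (ltW My)].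
Qed.

Lemma bounded_measurable_cst (c : R) : bounded_measurable (fun=> c).
Proof. by split; [exact: measurable_cst|exists `|c|]. Qed.

Lemma bounded_measurableD f g : bounded_measurable f -> bounded_measurable g ->
  bounded_measurable (fun x => f x + g x).
Proof.
move=> [mf [M fM]] [mg [N gN]]; split; first exact: measurable_funD.
by exists (M + N) => x; rewrite (le_trans (ler_normD _ _))// lerD.
Qed.

Lemma bounded_measurableM f g : bounded_measurable f -> bounded_measurable g ->
  bounded_measurable (fun x => f x * g x).
Proof.
move=> [mf [M fM]] [mg [N gN]]; split; first exact: measurable_funM.
by exists (M * N) => x; rewrite normrM ler_pM.
Qed.

Lemma bounded_measurableN f :
  bounded_measurable f -> bounded_measurable (fun x => - f x).
Proof.
move=> [mf [M fM]]; split; first exact: measurableT_comp.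
by exists M => x; rewrite normrN.
Qed.

Lemma bounded_measurable_norm f :
  bounded_measurable f -> bounded_measurable (fun x => `|f x|).
Proof.
move=> [mf [M fM]]; split; first exact: measurableT_comp.
by exists M => x; rewrite normr_id.
Qed.

Lemma bounded_measurable_sum (I : Type) (r : seq I) (p : pred I)
    (F : I -> T -> R) :
  (forall i, p i -> bounded_measurable (F i)) ->
  bounded_measurable (fun x => \sum_(i <- r | p i) F i x).
Proof.
move=> bF; elim: r => [|i r IH].
  under eq_fun do rewrite big_nil; exact: bounded_measurable_cst.
under eq_fun do rewrite big_cons; case pi: (p i) => //.
by apply: bounded_measurableD => //; exact: bF.
Qed.

Lemma bounded_measurable_indic (p : T -> bool) :
  measurable [set x | p x] -> bounded_measurable (fun x => (p x)%:R).
Proof.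
move=> mp; split.
  rewrite (_ : (fun x => _) = \1_[set x | p x]); first exact: measurable_indic.
  by apply/funext => x; rewrite indicE; congr (nat_of_bool _)%:R;
    apply/idP/idP; rewrite inE.
by exists 1 => x; case: (p x); rewrite ?normr1 ?normr0.
Qed.

Lemma Ex_cst (c : R) : Ex (fun=> c) = c.
Proof. by rewrite /Ex Rintegral_cst// [X in fine X]probability_setT mulr1. Qed.

Lemma ExD f g : bounded_measurable f -> bounded_measurable g ->
  Ex (fun x => f x + g x) = Ex f + Ex g.
Proof. by move=> bf bg; rewrite /Ex RintegralD//; exact: bounded_measurable_integrable. Qed.

Lemma ExB f g : bounded_measurable f -> bounded_measurable g ->
  Ex (fun x => f x - g x) = Ex f - Ex g.
Proof. by move=> bf bg; rewrite /Ex RintegralB//; exact: bounded_measurable_integrable. Qed.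

Lemma ExZ (c : R) f : bounded_measurable f -> Ex (fun x => c * f x) = c * Ex f.
Proof. by move=> bf; rewrite /Ex RintegralZl//; exact: bounded_measurable_integrable. Qed.

Lemma le_Ex f g : bounded_measurable f -> bounded_measurable g ->
  (forall x, f x <= g x) -> Ex f <= Ex g.
Proof.
by move=> bf bg fg; apply: le_Rintegral => //; exact: bounded_measurable_integrable.
Qed.

Lemma le_norm_Ex f : bounded_measurable f -> `|Ex f| <= Ex (fun x => `|f x|).
Proof. by move=> bf; apply: le_normr_Rintegral => //; exact: bounded_measurable_integrable. Qed.

Lemma Ex_ge0 f : (forall x, 0 <= f x) -> 0 <= Ex f.
Proof. by move=> f0; apply: Rintegral_ge0. Qed.

Lemma Ex_sum (I : Type) (r : seq I) (p : pred I) (F : I -> T -> R) :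
  (forall i, p i -> bounded_measurable (F i)) ->
  Ex (fun x => \sum_(i <- r | p i) F i x) = \sum_(i <- r | p i) Ex (F i).
Proof.
move=> bF; elim: r => [|i r IH].
  by under [X in Ex X]eq_fun do rewrite big_nil; rewrite big_nil Ex_cst.
under [X in Ex X]eq_fun do rewrite big_cons; rewrite big_cons; case pi: (p i) => //.
by rewrite ExD ?IH//; [exact: bF|exact: bounded_measurable_sum].
Qed.

Lemma Ex_indic (p : T -> bool) :
  measurable [set x | p x] -> Ex (fun x => (p x)%:R) = fine (P [set x | p x]).
Proof.
move=> mp; rewrite /Ex (_ : (fun x => _) = \1_[set x | p x]).
  by rewrite /Rintegral integral_indic// setIT.
by apply/funext => x; rewrite indicE; congr (nat_of_bool _)%:R;
  apply/idP/idP; rewrite inE.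
Qed.

End BoundedExpectation.

(** * Finite truncations of independent waiting times *)

(** A function of the first J coordinates is constant on each of the countably many
atoms {(t_0, ..., t_(J-1)) = s}. *)
Lemma prefix_measurable {d dV} {T : measurableType d} {V : measurableType dV}
    (tau : nat -> T -> nat) (J : nat) (F : (nat -> nat) -> V) :
  (forall i k, (i < J)%N -> measurable (tau i @^-1` [set k])) ->
  (forall t u, (forall i, (i < J)%N -> t i = u i) -> F t = F u) ->
  measurable_fun setT (fun o => F (tau ^~ o)).
Proof.
move=> mtau FJ _ Y mY; rewrite setTI.
pose atom (s : seq nat) : set T := [set o | forall i, (i < J)%N -> tau i o = nth 0%N s i].
have -> : (fun o => F (tau ^~ o)) @^-1` Y =
    \bigcup_(s : seq nat) (if `[< Y (F (nth 0%N s)) >] then atom s else set0).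
  apply/seteqP; split=> o /=.
    move=> Yo; exists (mkseq (tau ^~ o) J) => //.
    have E i : (i < J)%N -> tau i o = nth 0%N (mkseq (tau ^~ o) J) i.
      by move=> iJ; rewrite nth_mkseq.
    by rewrite -(FJ (tau ^~ o) _ E); case: asboolP.
  by case=> s _; case: asboolP => // Ys os; rewrite (FJ _ _ os).
apply: countable_bigcupT_measurable => // s; case: ifP => // _.
have -> : atom s = \bigcap_(i in `I_J) tau i @^-1` [set nth 0%N s i] by [].
by apply: bigcap_measurableType => i; exact: mtau.
Qed.

Section Iid.
Context {R : realType} {d} {T : measurableType d} (P : probability T R).
Variable tau : nat -> {RV P >-> nat}.

Lemma measurable_RV_fiber i k : measurable (tau i @^-1` [set k]).
Proof. by rewrite -[X in measurable X]setTI; exact: measurable_funP. Qed.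

Lemma prefix_bounded_measurable (J : nat) (F : (nat -> nat) -> R) (M : R) :
  (forall t u, (forall i, (i < J)%N -> t i = u i) -> F t = F u) ->
  (forall t, `|F t| <= M) ->
  bounded_measurable (fun o => F (tau ^~ o)).
Proof. by move=> FJ FM; split; [|exists M => //];
  apply: prefix_measurable FJ => i k _; exact: measurable_RV_fiber. Qed.

Lemma prefix_bounded_measurable_bool (J : nat) (F : (nat -> nat) -> bool) :
  (forall t u, (forall i, (i < J)%N -> t i = u i) -> F t = F u) ->
  bounded_measurable (fun o => (F (tau ^~ o))%:R : R).
Proof.
move=> FJ; apply: (@prefix_bounded_measurable J (fun t => (F t)%:R) 1) => [t u tu|t].
  by rewrite (FJ t u).
by case: (F t); rewrite ?normr1 ?normr0.
Qed.

Definition cap (L t : nat) : 'I_L.+1 := inord (minn t L).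

(** A value in a finite type, so that events about truncated waiting times form a
finite partition. *)
Definition capped (L J : nat) (t : nat -> nat) : {ffun 'I_J -> 'I_L.+1} :=
  [ffun i : 'I_J => cap L (t i)].

Lemma capE L t : cap L t = minn t L :> nat.
Proof. by rewrite inordK// ltnS geq_minr. Qed.

Lemma capped_prefix L J t u :
  (forall i, (i < J)%N -> t i = u i) -> capped L J t = capped L J u.
Proof. by move=> tu; apply/ffunP => i; rewrite !ffunE tu. Qed.

Lemma capped_bounded_measurable L J (F : {ffun 'I_J -> 'I_L.+1} -> R) :
  bounded_measurable (fun o => F (capped L J (tau ^~ o))).
Proof.
apply: (@prefix_bounded_measurable J (fun t => F (capped L J t))
  (\sum_s `|F s|)) => [t u /(capped_prefix L) ->//|t].
by rewrite (bigD1 (capped L J t))//= lerDl sumr_ge0.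
Qed.

Variable pi : probability nat R.

Definition iid_law :=
  (forall i A, distribution P (tau i) A = pi A) /\
  mutually_independent P (fun i => tau i : T -> nat).

Lemma nat_bounded_measurable (f : nat -> R) (M : R) :
  (forall t, `|f t| <= M) -> @bounded_measurable R _ nat f.
Proof. by move=> fM; split=> [_ Y mY|]; [rewrite setTI|exists M]. Qed.

Lemma nat_bounded_measurable_bool (p : nat -> bool) :
  @bounded_measurable R _ nat (fun t => (p t)%:R).
Proof.
by apply: (@nat_bounded_measurable _ 1) => t; case: (p t); rewrite ?normr1 ?normr0.
Qed.

Hypothesis iid : iid_law.

Lemma Ex_capped_atom L J (s : {ffun 'I_J -> 'I_L.+1}) :
  Ex P (fun o => (capped L J (tau ^~ o) == s)%:R) =
  \prod_(i < J) Ex pi (fun t => (cap L t == s i)%:R).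
Proof.
have [law indep] := iid.
rewrite Ex_indic; last first.
  have /(_ measurableT [set true]) := prefix_measurable
    (fun i => tau i : T -> nat) J (fun t => capped L J t == s)
    (fun i k _ => measurable_RV_fiber i k)
    (fun t u tu => congr1 (fun x => x == s) (capped_prefix L J t u tu)).
  by rewrite setTI; apply.
pose A i : set nat := [set t | forall iJ : (i < J)%N, cap L t == s (Ordinal iJ)].
have [JJ memJJ permJJ] : exists2 JJ : {fset nat},
    forall i, (i \in JJ) = (i < J)%N & perm_eq JJ (iota 0 J).
  exists (seq_fset tt (iota 0 J)) => [i|]; first by rewrite seq_fsetE mem_iota.
  by rewrite (perm_trans (seq_fset_perm _ _))// undup_id// iota_uniq.
have -> : [set o | capped L J (tau ^~ o) == s] =
    \bigcap_(i in [set` JJ]) (tau i @^-1` A i).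
  apply/seteqP; split=> o /=.
    by move=> /eqP/ffunP os i /= _ iJ; rewrite -(os (Ordinal iJ)) ffunE.
  move=> os; apply/eqP/ffunP => i; rewrite ffunE; apply/eqP.
  have := os i; rewrite /= memJJ ltn_ord => /(_ isT (ltn_ord i)).
  by rewrite (_ : Ordinal _ = i)//; apply: val_inj.
rewrite (indep _ A) (perm_big (iota 0 J))//=.
have -> : iota 0 J = index_iota 0 J by rewrite /index_iota subn0.
rewrite big_mkord.
have finE (i : 'I_J) : P (tau i @^-1` A i) = (fine (pi (A i)))%:E.
  rewrite -[LHS]/(distribution P (tau i) (A i)) law fineK//.
  exact: fin_num_measure.
rewrite (eq_bigr (fun i : 'I_J => (fine (pi (A i)))%:E)) => [|i _]; last exact: finE.
rewrite prodEFin/=; apply: eq_bigr => i _.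
rewrite Ex_indic//; congr (fine (pi _)).
apply/seteqP; split=> t /=; first by move=> /(_ (ltn_ord i)); rewrite (_ : Ordinal _ = i)//; apply: val_inj.
by move=> ti iJ; rewrite (_ : Ordinal _ = i)//; apply: val_inj.
Qed.

(** Truncated waiting times live in a finite set, so that expectations become
finite sums in which pi is the only data.  This is the form in which
independence and the law pi are used: it serves both to factor exponential
moments and to compare different probability spaces. *)
Lemma Ex_capped L J (F : {ffun 'I_J -> 'I_L.+1} -> R) :
  Ex P (fun o => F (capped L J (tau ^~ o))) =
  \sum_s F s * \prod_(i < J) Ex pi (fun t => (cap L t == s i)%:R).
Proof.
have E o : F (capped L J (tau ^~ o)) =
    \sum_s F s * (capped L J (tau ^~ o) == s)%:R.
  rewrite (bigD1 (capped L J (tau ^~ o)))//= eqxx mulr1 big1 ?addr0// => s sc.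
  by rewrite eq_sym (negbTE sc) mulr0.
under [X in Ex _ X]eq_fun do rewrite E.
have bm s : bounded_measurable (fun o => (capped L J (tau ^~ o) == s)%:R : R).
  exact: (capped_bounded_measurable _ _ (fun c => (c == s)%:R)).
rewrite Ex_sum; last first.
  by move=> s _; apply: bounded_measurableM => //; exact: bounded_measurable_cst.
by apply: eq_bigr => s _; rewrite ExZ// Ex_capped_atom.
Qed.

Lemma Ex_prod_capped L J (f : nat -> R) :
  Ex P (fun o => \prod_(i < J) f (minn (tau i o) L)) =
  Ex pi (fun t => f (minn t L)) ^+ J.
Proof.
pose F (s : {ffun 'I_J -> 'I_L.+1}) : R := \prod_(i < J) f (s i).
transitivity (Ex P (fun o => F (capped L J (tau ^~ o)))).
  congr Ex; apply/funext => o; apply: eq_bigr => i _.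
  by rewrite ffunE capE.
rewrite Ex_capped /F.
under eq_bigr do rewrite -big_split/=.
rewrite -(bigA_distr_bigA
  (fun (i : 'I_J) (v : 'I_L.+1) => f v * Ex pi (fun t => (cap L t == v)%:R))).
rewrite prodr_const cardT size_enum_ord; congr (_ ^+ _).
have E1 t : f (minn t L) = \sum_(v < L.+1) f v * (cap L t == v)%:R.
  rewrite (bigD1 (cap L t))//= eqxx mulr1 capE big1 ?addr0// => v vc.
  by rewrite eq_sym (negbTE vc) mulr0.
under [X in Ex _ X]eq_fun do rewrite E1.
rewrite Ex_sum; last first.
  move=> v _; apply: bounded_measurableM; first exact: bounded_measurable_cst.
  exact: nat_bounded_measurable_bool.
apply: eq_bigr => v _; rewrite ExZ//.
exact: nat_bounded_measurable_bool.
Qed.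

End Iid.

(** * Counting the added balls *)

Definition arrival_count (J : nat) (t : nat -> nat) (i : nat) : nat :=
  (\sum_(j < J) (arrival t j <= i))%N.

Lemma arrivalS t i : arrival t i.+1 = (arrival t i + t i.+1)%N.
Proof. by rewrite /arrival big_ord_recr. Qed.

Lemma leq_arrival t i j : (i <= j)%N -> (arrival t i <= arrival t j)%N.
Proof.
move=> /subnK <-; elim: (j - i)%N => [|m IH]; first by rewrite add0n.
by rewrite addSn arrivalS (leq_trans IH) ?leq_addr.
Qed.

Lemma eq_arrival t u i :
  (forall j, (j <= i)%N -> t j = u j) -> arrival t i = arrival u i.
Proof. by move=> tu; apply: eq_bigr => j _; rewrite tu// -ltnS. Qed.

Lemma eq_arrival_count J t u i : (forall j, (j < J)%N -> t j = u j) ->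
  arrival_count J t i = arrival_count J u i.
Proof.
move=> tu; apply: eq_bigr => j _; rewrite (eq_arrival t u)// => l lj.
by rewrite tu// (leq_ltn_trans lj).
Qed.

(** Truncation at a level L > n does not change which partial sums are at most n:
a truncated summand already exceeds n. *)
Lemma arrival_minn t L i n : (n < L)%N ->
  (arrival (fun j => minn (t j) L) i <= n)%N = (arrival t i <= n)%N.
Proof.
move=> nL; apply/idP/idP => [mn|tn]; last first.
  by apply: leq_trans tn; apply: leq_sum => j _; exact: geq_minl.
have small (j : 'I_i.+1) : (t j <= L)%N.
  rewrite leqNgt; apply/negP => Lt; move: mn.
  rewrite /arrival (bigD1 j)//= (minn_idPr (ltnW Lt)) => mn.
  by move: (leq_ltn_trans (leq_trans (leq_addr _ _) mn) nL); rewrite ltnn.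
apply: leq_trans mn; rewrite /arrival; apply: leq_sum => j _.
by rewrite (minn_idPl (small j)).
Qed.

Lemma arrival_count_minn J t L n : (n < L)%N ->
  arrival_count J (fun j => minn (t j) L) n = arrival_count J t n.
Proof. by move=> nL; apply: eq_bigr => j _; rewrite arrival_minn. Qed.

Lemma arrival_count_le J t h n :
  (n < arrival t h)%N -> (arrival_count J t n <= h)%N.
Proof.
move=> nh; rewrite /arrival_count.
rewrite -(big_mkord xpredT (fun j => nat_of_bool (arrival t j <= n)%N)).
have late j : (h <= j)%N -> (arrival t j <= n)%N = false.
  by move=> hj; rewrite leqNgt (leq_trans nh (leq_arrival t _ _ hj)).
have [Jh|hJ] := leqP J h.
  apply: leq_trans Jh; rewrite -[leqRHS]subn0 -[leqRHS]muln1 -sum_nat_const_nat.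
  by apply: leq_sum => j _; rewrite leq_b1.
rewrite (big_cat_nat (n := h))//=; last exact: ltnW.
have -> : (\sum_(h <= j < J) (arrival t j <= n) = 0)%N.
  by rewrite big_nat_cond big1// => j /andP[/andP[hj _] _]; rewrite late.
rewrite addn0.
rewrite -[leqRHS]subn0 -[leqRHS]muln1 -sum_nat_const_nat.
by apply: leq_sum => j _; rewrite leq_b1.
Qed.

Lemma arrival_count_ge J t l n : (l < J)%N ->
  (arrival t l <= n)%N -> (l.+1 <= arrival_count J t n)%N.
Proof.
move=> lJ ln; rewrite /arrival_count.
rewrite -(big_mkord xpredT (fun j => nat_of_bool (arrival t j <= n)%N)).
rewrite (big_cat_nat (n := l.+1))//=; apply: leq_trans (leq_addr _ _).
rewrite -[leqLHS]subn0 -[leqLHS]muln1 -sum_nat_const_nat.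
rewrite big_nat_cond [leqRHS]big_nat_cond; apply: leq_sum => j /andP[/andP[_ jl] _].
by rewrite (leq_trans (leq_arrival t _ _ _) ln).
Qed.

(** The hypothesis excludes infinitely many coinciding arrivals, for which the
cardinality in [arrivals_at] is meaningless. *)
Lemma arrivals_at_count J t n m : (n < arrival t J)%N -> (m <= n)%N ->
  arrivals_at t m = (\sum_(j < J) (arrival t j == m))%N.
Proof.
move=> nJ mn; rewrite /arrivals_at.
pose X : {fset nat} := seq_fset tt [seq i <- iota 0 J | arrival t i == m].
have memX i : (i \in X) = (arrival t i == m) && (i < J)%N.
  by rewrite /X seq_fsetE mem_filter mem_iota leq0n add0n.
have -> : [set i | arrival t i = m] = [set` X].
  apply/seteqP; split=> i /=; rewrite memX.
    move=> im; rewrite im eqxx/= ltnNge; apply/negP => Ji.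
    by move: (leq_trans nJ (leq_arrival t _ _ Ji)); rewrite im ltnNge mn.
  by case/andP=> /eqP.
rewrite set_fsetK size_seq_fset undup_id ?filter_uniq ?iota_uniq// size_filter.
rewrite -sum1_count big_mkcond/= -(subn0 J) -/(index_iota 0 J) big_mkord subn0.
by apply: eq_bigr => j _; case: eqP.
Qed.

Lemma sum_arrivals_at J t n i : (n < arrival t J)%N -> (i <= n)%N ->
  (\sum_(m < i.+1) arrivals_at t m)%N = arrival_count J t i.
Proof.
move=> nJ il; under eq_bigr => m _.
  rewrite (arrivals_at_count _ _ _ _ nJ); last by rewrite (leq_trans _ il)// -ltnS.
  over.
rewrite exchange_big/=; apply: eq_bigr => j _.
have [ji|ij] := leqP (arrival t j) i.
  rewrite (bigD1 (inord (arrival t j) : 'I_i.+1))//= inordK// eqxx big1// => m.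
  apply: contraNeq; rewrite eqb0 negbK => /eqP jm.
  by apply/eqP/val_inj; rewrite /= jm inordK.
rewrite big1// => m _; apply/eqP; rewrite eqb0; apply/eqP => jm.
by move: ij; rewrite jm ltnNge -ltnS ltn_ord.
Qed.

Lemma urn_total b w t c n :
  ((urn b w t c n).1 + (urn b w t c n).2 =
   b + w + n + \sum_(m < n.+1) arrivals_at t m)%N.
Proof.
elim: n => [|n IH]; first by rewrite big_ord1/=; lia.
rewrite big_ord_recr/=; move: IH; case: (urn b w t c n) => x y /=.
by case: (c n) => /=; lia.
Qed.

Lemma urn_white b w t c n : (urn b w t c n).2 = (w + \sum_(j < n) c j)%N.
Proof.
elim: n => [|n IH]; first by rewrite big_ord0 addn0.
by rewrite big_ord_recr/=; move: IH; case: (urn b w t c n) => x y /= ->; rewrite addnA.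
Qed.

(** * Rising factorials and the growth product *)

Definition rising (k x : nat) : nat := (\prod_(i < k) (x + i))%N.

(** Equivalently, (x + 1)^(k) - x^(k) = k x^(k) / x: the increment of x^(k) at a
white draw is k x^(k) / x, and multiplied by the probability x / N of such a
draw it is proportional to x^(k) again. *)
Lemma risingS k x : (rising k x.+1 * x = rising k x * (x + k))%N.
Proof.
have E : (x * rising k x.+1 = rising k.+1 x)%N.
  rewrite /rising big_ord_recl/= addn0; congr (_ * _)%N.
  by apply: eq_bigr => i _; rewrite /bump/= addnA addn1.
by rewrite mulnC E /rising big_ord_recr.
Qed.

Lemma leq_rising k x y : (x <= y)%N -> (rising k x <= rising k y)%N.
Proof. by move=> xy; apply: leq_prod => i _; rewrite leq_add2r. Qed.

Section Growth.
Context {R : realType}.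

(** The factor by which the k-th rising factorial moment has grown after n steps,
given the waiting times, if only the first J additions are taken into account
and the urn starts with s balls. *)
Definition growth (k s J : nat) (t : nat -> nat) (n : nat) : R :=
  \prod_(i < n) (1 + k%:R / (s + i + arrival_count J t i)%:R).

Lemma growthS k s J t n :
  growth k s J t n.+1 =
  growth k s J t n * (1 + k%:R / (s + n + arrival_count J t n)%:R).
Proof. by rewrite /growth big_ord_recr. Qed.

Lemma growth_ge0 k s J t n : 0 <= growth k s J t n.
Proof. by apply: prodr_ge0 => i _; rewrite addr_ge0 ?divr_ge0. Qed.

(** The product is largest when no extra black ball arrives, and then its factors
are at most 1 + k / (i + 1) <= ((i + 2) / (i + 1))^k by Bernoulli's inequality. *)
Lemma growth_le k s J t n : (0 < s)%N -> growth k s J t n <= n.+1%:R ^+ k.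
Proof.
move=> s0; elim: n => [|n IH]; first by rewrite /growth big_ord0 expr1n.
rewrite growthS.
have n0 : (0 : R) < n.+1%:R by rewrite ltr0n.
have -> : n.+2%:R ^+ k = n.+1%:R ^+ k * (1 + n.+1%:R^-1) ^+ k :> R.
  by rewrite -exprMn mulrDr mulr1 divff ?gt_eqF// -natr1.
apply: (ler_pM (growth_ge0 _ _ _ _ _) _ IH); first by rewrite addr_ge0 ?divr_ge0.
have bern (x : R) m : 0 <= x -> 1 + m%:R * x <= (1 + x) ^+ m.
  move=> x0; elim: m => [|m IHm]; first by rewrite mul0r addr0 expr0.
  have x1 : 0 <= 1 + x by rewrite addr_ge0.
  rewrite exprS; apply: le_trans (ler_wpM2l x1 IHm).
  have : 0 <= x * (m%:R * x) by rewrite !mulr_ge0.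
  by rewrite -natr1; lra.
apply: le_trans (bern _ _ _); last by rewrite invr_ge0.
rewrite lerD2l ler_wpM2l// lef_pV2 ?posrE ?ltr0n ?ler_nat; lia.
Qed.

Lemma eq_growth k s J t u n :
  (forall i, (i < n)%N -> arrival_count J t i = arrival_count J u i) ->
  growth k s J t n = growth k s J u n.
Proof. by move=> tu; apply: eq_bigr => i _; rewrite tu. Qed.

Lemma growth_bounded_measurable {d} {T : measurableType d}
    (P : probability T R) (tau : nat -> {RV P >-> nat}) k s J n : (0 < s)%N ->
  bounded_measurable (fun o => growth k s J (tau ^~ o) n).
Proof.
move=> s0; apply: (prefix_bounded_measurable P tau J
  (fun t => growth k s J t n) (n.+1%:R ^+ k)) => [t u tu|t].
  by apply: eq_growth => i _; exact: eq_arrival_count.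
by rewrite ger0_norm ?growth_ge0// growth_le.
Qed.

End Growth.

Section Process.
Context {R : realType} (pi : probability nat R) (b w : nat)
  {d} {T : measurableType d} (P : probability T R)
  (tau : nat -> {RV P >-> nat}) (draw : nat -> {RV P >-> bool})
  (white : nat -> {RV P >-> nat}).
Hypothesis urnP : urn_process pi b w tau draw white.

Let hist := history (fun i => tau i : T -> nat) (fun j => draw j : T -> bool).

Lemma white_le n o : (white n o <= w + n)%N.
Proof.
rewrite (white_count urnP) urn_white leq_add2l.
rewrite -[leqRHS]card_ord -sum1_card; apply: leq_sum => j _; exact: leq_b1.
Qed.

Lemma white_ge n o : (w <= white n o)%N.
Proof. by rewrite (white_count urnP) urn_white leq_addr. Qed.

Lemma whiteS n o : white n.+1 o = (white n o + draw n o)%N.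
Proof. by rewrite !(white_count urnP) !urn_white big_ord_recr/= addnA. Qed.

Lemma white_bounded_measurable (f : nat -> R) n :
  bounded_measurable (fun o => f (white n o)).
Proof.
split.
  have mf : measurable_fun [set: nat] f by move=> _ Y mY; rewrite setTI.
  exact: (measurableT_comp mf (measurable_funP (white n))).
exists (\sum_(i < (w + n).+1) `|f i|) => o.
have x := white_le n o; rewrite -ltnS in x.
by rewrite (bigD1 (Ordinal x))//= lerDl sumr_ge0.
Qed.

Lemma history_prefix n J (F : (nat -> nat) -> bool) :
  (forall t u, (forall i, (i < J)%N -> t i = u i) -> F t = F u) ->
  hist n [set o | F (tau ^~ o)].
Proof.
move=> FJ.
have := @prefix_measurable _ _ (g_sigma_algebraType [set A |
  (exists i k, A = tau i @^-1` [set k]) \/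
  (exists2 j, (j < n)%N & A = draw j @^-1` [set true])]) bool
  (fun i => tau i : T -> nat) J F.
move=> /(_ _ FJ measurableT [set true] I); rewrite setTI; apply => i k _.
by apply: sub_sigma_algebra; left; exists i, k.
Qed.

Lemma history_white n x : hist n [set o | white n o == x].
Proof.
(* Only the first n draws are in the history; the others are replaced by 0. *)
pose u (i : nat) (o : T) : nat := if (i < n)%N then draw i o : nat else 0%N.
pose F (t : nat -> nat) : bool := (w + \sum_(j < n) t j == x)%N.
have FJ t v : (forall i, (i < n)%N -> t i = v i) -> F t = F v.
  by move=> tv; congr (_ + _ == _)%N; apply: eq_bigr => j _; exact: tv.
have -> : [set o | white n o == x] = [set o | F (u ^~ o)].
  congr mkset; apply/funext => o; congr is_true.
  rewrite (white_count urnP) urn_white /F; congr (_ + _ == _)%N.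
  by apply: eq_bigr => j _; rewrite /u ltn_ord.
have := @prefix_measurable _ _ (g_sigma_algebraType [set A |
  (exists i k, A = tau i @^-1` [set k]) \/
  (exists2 j, (j < n)%N & A = draw j @^-1` [set true])]) bool u n F.
move=> /(_ _ FJ measurableT [set true] I); rewrite setTI; apply => i k iN.
have mD : @measurable _ (g_sigma_algebraType [set A |
  (exists i k, A = tau i @^-1` [set k]) \/
  (exists2 j, (j < n)%N & A = draw j @^-1` [set true])]) (draw i @^-1` [set true]).
  by apply: sub_sigma_algebra; right; exists i.
rewrite /u iN.
case: k => [|[|k]].
- rewrite (_ : _ @^-1` _ = ~` (draw i @^-1` [set true])); first exact: measurableC.
  by apply/seteqP; split=> o /=; case: (draw i o).
- rewrite (_ : _ @^-1` _ = draw i @^-1` [set true])//.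
  by apply/seteqP; split=> o /=; case: (draw i o).
- rewrite (_ : _ @^-1` _ = set0); first exact: measurable0.
  by apply/seteqP; split=> o //=; case: (draw i o).
Qed.

Lemma history_setI n A B : hist n A -> hist n B -> hist n (A `&` B).
Proof.
exact: (@measurableI _ (g_sigma_algebraType [set A |
  (exists i k, A = tau i @^-1` [set k]) \/
  (exists2 j, (j < n)%N & A = draw j @^-1` [set true])])).
Qed.

Lemma history_measurable n A : hist n A -> measurable A.
Proof.
move: A; apply: smallest_sub; first exact: sigma_algebra_measurable.
move=> A [[i [k ->]]|[j _ ->]]; first exact: measurable_RV_fiber.
by rewrite -[X in measurable X]setTI; exact: measurable_funP.
Qed.

(** On A the composition of the urn is fixed, so the conditional probability of a
white draw is a constant that leaves the integral. *)
Lemma draw_step n (A : T -> bool) (x N : nat) :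
  hist n [set o | A o] ->
  (forall o, A o -> urn b w (tau ^~ o) (draw ^~ o) n = (N - x, x)%N) -> (x <= N)%N ->
  Ex P (fun o => (A o && draw n o)%:R) = x%:R / N%:R * Ex P (fun o => (A o)%:R).
Proof.
move=> hA urnA xN; have mA := history_measurable n _ hA.
have mD : measurable (draw n @^-1` [set true]).
  by rewrite -[X in measurable X]setTI; exact: measurable_funP.
rewrite !Ex_indic//; last first.
  rewrite (_ : [set _ | _] = [set o | A o] `&` draw n @^-1` [set true]).
    exact: measurableI.
  by apply/seteqP; split=> o /=; [move=> /andP|move=> [-> ->]].
rewrite (_ : [set o | A o && draw n o] = [set o | A o] `&` draw n @^-1` [set true]); last first.
  by apply/seteqP; split=> o /=; [move=> /andP|move=> [-> ->]].
have -> := draw_uniform urnP hA.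
rewrite (eq_integral (cst (x%:R / N%:R)%:E)); last first.
  by move=> o; rewrite inE => /urnA -> /=; rewrite subnK.
rewrite integral_cst// fineM//.
exact: fin_num_measure.
Qed.

End Process.

Lemma capped_minn L J t u i : capped L J t = capped L J u -> (i < J)%N ->
  minn (t i) L = minn (u i) L.
Proof.
move=> /ffunP tu iJ; have := tu (Ordinal iJ); rewrite !ffunE/= => /(congr1 val).
by rewrite /= !capE.
Qed.

Lemma capped_arrival L J t u j n : capped L J t = capped L J u ->
  (j < J)%N -> (n < L)%N -> (arrival t j <= n)%N = (arrival u j <= n)%N.
Proof.
move=> tu jJ nL; rewrite -(arrival_minn t L)// -(arrival_minn u L)//.
congr (_ <= _)%N; apply: eq_arrival => i ij.
by apply: capped_minn tu _; exact: leq_ltn_trans jJ.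
Qed.

Lemma capped_arrival_count L J t u n : capped L J.+1 t = capped L J.+1 u ->
  (n < L)%N -> arrival_count J t n = arrival_count J u n.
Proof.
move=> tu nL; apply: eq_bigr => j _; congr nat_of_bool.
by apply: capped_arrival tu _ nL; exact: leqW.
Qed.

Section Moments.
Context {R : realType} (pi : probability nat R) (b w : nat)
  {d} {T : measurableType d} (P : probability T R)
  (tau : nat -> {RV P >-> nat}) (draw : nat -> {RV P >-> bool})
  (white : nat -> {RV P >-> nat}).
Hypothesis urnP : urn_process pi b w tau draw white.
Hypothesis w0 : (0 < w)%N.

(** Conditionally on the truncated waiting times, the rising factorial moments
obey an exact linear recursion.  The condition on [t] makes the number of balls
constant on the atom at all times m <= n.  The induction step slices the atom by
the current number of white balls, so that the conditional probability of a
white draw is constant as well. *)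
Lemma atom_moment (k n J : nat) (t : nat -> nat) (m : nat) :
  (n < arrival t J)%N -> (m <= n)%N ->
  let atom o := capped n.+1 J.+1 (tau ^~ o) == capped n.+1 J.+1 t in
  Ex P (fun o => (rising k (white m o))%:R * (atom o)%:R) =
  (rising k w)%:R * growth k (b + w) J t m * Ex P (fun o => (atom o)%:R).
Proof.
move=> nJ mn atom; elim: m mn => [_|m IH mn].
  rewrite /growth big_ord0 mulr1.
  have whiteE o : white 0%N o = w by rewrite (white_count urnP) urn_white big_ord0 addn0.
  under [X in Ex _ X]eq_fun do rewrite whiteE.
  rewrite ExZ//; apply: (capped_bounded_measurable P tau _ _ (fun c => (c == _)%:R)).
pose N := (b + w + m + arrival_count J t m)%N.
have atomJ o : atom o -> (n < arrival (tau ^~ o) J)%N.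
  move/eqP => atomo; rewrite ltnNge (capped_arrival _ _ _ _ _ _ atomo)//.
  by rewrite -ltnNge.
have urnE o : atom o ->
    urn b w (tau ^~ o) (draw ^~ o) m = (N - white m o, white m o)%N /\
    (white m o <= N)%N.
  move=> atomo.
  have := urn_total b w (tau ^~ o) (draw ^~ o) m.
  rewrite (sum_arrivals_at _ _ _ _ (atomJ o atomo) (ltnW mn)).
  have /eqP tu := atomo.
  rewrite (capped_arrival_count _ _ _ _ m tu); last by rewrite ltnS ltnW.
  rewrite -/N (white_count urnP).
  by case: (urn _ _ _ _ _) => x y /= <-; rewrite addnK leq_addl.
have N0 : (0 < N)%N by rewrite /N; lia.
pose K := (w + m).+1.
pose slice x o : bool := atom o && (white m o == x).
have hist_slice x : history (fun i => tau i : T -> nat) (fun j => draw j : T -> bool) m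
    [set o | slice x o].
  rewrite (_ : [set o | slice x o] = [set o | atom o] `&` [set o | white m o == x]); last first.
    by apply/seteqP; split=> o /=; [move/andP|case=> ? ?; apply/andP].
  apply: (history_setI P tau draw m); last exact: (history_white _ _ _ _ _ _ _ urnP).
  apply: (history_prefix _ _ _ _ J.+1 (fun u => capped n.+1 J.+1 u == capped n.+1 J.+1 t)).
  by move=> u v uv; rewrite (capped_prefix _ _ u v uv).
have m_slice x : measurable [set o | slice x o].
  exact: history_measurable (hist_slice x).
have mD : measurable [set o | draw m o].
  by rewrite -[X in measurable X]setTI; exact: (measurable_funP (draw m) measurableT [set true]).
have b_slice x : bounded_measurable (fun o => (slice x o)%:R : R).
  exact: bounded_measurable_indic.
have b_sliceD x : bounded_measurable (fun o => (slice x o && draw m o)%:R : R).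
  apply: bounded_measurable_indic.
  rewrite (_ : [set o | slice x o && draw m o] = [set o | slice x o] `&` [set o | draw m o]).
    exact: measurableI.
  by apply/seteqP; split=> o /=; [move/andP|case=> ? ?; apply/andP].
have slices (f : nat -> R) o :
    f (white m o) * (atom o)%:R = \sum_(x < K) f x * (slice x o)%:R.
  have xK : (white m o < K)%N by rewrite ltnS (white_le _ _ _ _ _ _ _ urnP).
  rewrite (bigD1 (Ordinal xK))//= big1 ?addr0; last first.
    move=> i; rewrite -val_eqE/= => iw.
    by rewrite /slice eq_sym (negbTE iw) andbF mulr0.
  by rewrite /slice eqxx andbT.
have step o : (rising k (white m.+1 o))%:R * (atom o)%:R =
    \sum_(x < K) ((rising k x)%:R * (slice x o)%:R
      + ((rising k x.+1)%:R - (rising k x)%:R) * (slice x o && draw m o)%:R) :> R.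
  rewrite big_split/= -(slices (fun x => (rising k x)%:R)).
  have -> : \sum_(x < K) ((rising k x.+1)%:R - (rising k x)%:R) * (slice x o && draw m o)%:R
      = (draw m o)%:R * \sum_(x < K) ((rising k x.+1)%:R - (rising k x)%:R) * (slice x o)%:R :> R.
    rewrite mulr_sumr; apply: eq_bigr => x _.
    by case: (draw m o); rewrite ?andbT ?andbF ?mulr0 ?mul1r ?mul0r.
  rewrite -(slices (fun x => (rising k x.+1)%:R - (rising k x)%:R)).
  rewrite (whiteS _ _ _ _ _ _ _ urnP).
  by case: (draw m o); rewrite ?addn0 ?addn1 ?mul0r ?addr0// mul1r -mulrDl addrC subrK.
under [X in Ex _ X]eq_fun do rewrite step.
rewrite Ex_sum; last first.
  by move=> x _; apply: bounded_measurableD; apply: bounded_measurableM => //;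
    exact: bounded_measurable_cst.
rewrite growthS -/N.
transitivity (\sum_(x < K) (1 + k%:R / N%:R) * ((rising k x)%:R * Ex P (fun o => (slice x o)%:R : R))).
  apply: eq_bigr => x _.
  rewrite ExD ?ExZ//; do ?by apply: bounded_measurableM => //; exact: bounded_measurable_cst.
  have -> : Ex P (fun o => (slice x o && draw m o)%:R : R) =
      x%:R / N%:R * Ex P (fun o => (slice x o)%:R).
    have [xN|Nx] := leqP x N.
      apply: (draw_step _ _ _ _ _ _ _ urnP) => // o /andP[/urnE[-> _] /eqP ->//].
    have slice0 o : slice x o = false.
      apply/negP => /andP[/urnE[_ wN] /eqP wx].
      by move: Nx; rewrite -wx ltnNge wN.
    under [X in Ex _ X]eq_fun do rewrite slice0.
    under [X in _ = _ * Ex _ X]eq_fun do rewrite slice0.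
    by rewrite Ex_cst mulr0.
  have rS : (rising k x.+1)%:R * x%:R = (rising k x)%:R * (x%:R + k%:R) :> R.
    by rewrite -natrD -!natrM risingS.
  have N1 : (N%:R : R) != 0 by rewrite pnatr_eq0 -lt0n.
  rewrite !mulrA -mulrDl; congr (_ * _).
  rewrite mulrBl rS; field.
  exact: N1.
rewrite -mulr_sumr.
have -> : \sum_(x < K) (rising k x)%:R * Ex P (fun o => (slice x o)%:R : R) =
    Ex P (fun o => (rising k (white m o))%:R * (atom o)%:R).
  under [X in _ = Ex _ X]eq_fun do rewrite (slices (fun x => (rising k x)%:R)).
  rewrite Ex_sum; last first.
    by move=> x _; apply: bounded_measurableM => //; exact: bounded_measurable_cst.
  by apply: eq_bigr => x _; rewrite ExZ.
by rewrite (IH (ltnW mn)) mulrCA !mulrA; congr (_ * _); rewrite mulrAC mulrC mulrA.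
Qed.

End Moments.

(** * Replacing the added balls by finitely many of them *)

Section Tail.
Context {R : realType} {d} {T : measurableType d} (P : probability T R)
  (tau : nat -> {RV P >-> nat}) (pi : probability nat R).
Hypothesis iid : iid_law P tau pi.

Lemma chernoff (theta y : R) (L J : nat) :
  Ex P (fun o => (y <= \sum_(i < J) theta * (minn (tau i o) L)%:R)%R%:R) <=
  expR (- y) * Ex pi (fun t => expR (theta * (minn t L)%:R)) ^+ J.
Proof.
rewrite -(Ex_prod_capped P tau pi iid L J (fun v => expR (theta * v%:R))).
pose F (c : {ffun 'I_J -> 'I_L.+1}) : R := \prod_(i < J) expR (theta * (c i)%:R).
have FE o : F (capped L J (tau ^~ o)) = \prod_(i < J) expR (theta * (minn (tau i o) L)%:R).
  by apply: eq_bigr => i _; rewrite ffunE capE.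
have bF : bounded_measurable (fun o => \prod_(i < J) expR (theta * (minn (tau i o) L)%:R)).
  by rewrite -(funext FE); exact: capped_bounded_measurable.
rewrite -ExZ//; apply: le_Ex.
- apply: (prefix_bounded_measurable_bool P tau J
    (fun t => y <= \sum_(i < J) theta * (minn (t i) L)%:R)) => t u tu.
  by congr (_ <= _); apply: eq_bigr => i _; rewrite tu.
- by apply: bounded_measurableM => //; exact: bounded_measurable_cst.
move=> o; rewrite -expR_sum -expRD.
case: (leP y) => yo /=; last exact: expR_ge0.
rewrite mulr1n -[leLHS]expR0 ler_expR; by rewrite addrC subr_ge0.
Qed.

Lemma mean_gt0_mass : (0 < mean pi)%E -> 0 < Ex pi (fun t => (0 < t)%N%:R).
Proof.
move=> mu0; rewrite lt_neqAle Ex_ge0 ?andbT; last by move=> t; exact: ler0n.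
apply/eqP => pi0.
have : pi [set t | (0 < t)%N] = 0%E.
  by rewrite -[LHS]fineK ?fin_num_measure// -Ex_indic// -pi0.
move=> {}pi0; move: mu0; rewrite /mean.
have -> : (\int[pi]_t (t%:R)%:E = \int[pi]_(t in [set t : nat | (0 < t)%N]) (t%:R)%:E)%E.
  rewrite [RHS]integral_mkcond; apply: eq_integral => t _.
  rewrite patchE; case: ifPn => //; rewrite notin_setE/= => /negP.
  by rewrite -eqn0Ngt => /eqP ->.
by rewrite null_set_integral ?ltxx.
Qed.

(** A sum of J + 1 waiting times is at most n only if at most n
of them are positive; the exponential moment of min(tau, 1) turns this into a
geometric bound, since P(tau > 0) > 0. *)
Lemma arrival_tail (n : nat) : (0 < mean pi)%E ->
  Ex P (fun o => (arrival (tau ^~ o) J <= n)%N%:R : R) @[J --> \oo] --> (0 : R).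
Proof.
move=> mu0.
(* The exponential moment of min(tau, 1), which is 1 - (1 - 1/e) P(tau > 0). *)
pose rho := Ex pi (fun t => expR (- 1 * (minn t 1)%:R)).
have rho0 : 0 <= rho by apply: Ex_ge0 => t; exact: expR_ge0.
have rho1 : rho < 1.
  have E t : expR (- 1 * (minn t 1)%:R) = 1 - (1 - expR (-1)) * (0 < t)%N%:R :> R.
    case: t => [|t]; first by rewrite min0n !mulr0 expR0 subr0.
    by rewrite (minn_idPr _)// !mulr1 opprB addrC subrK.
  rewrite /rho; under [X in Ex _ X]eq_fun do rewrite E.
  have bm := nat_bounded_measurable_bool (R := R) (fun t => 0 < t)%N.
  rewrite ExB ?Ex_cst ?ExZ//.
  - rewrite ltrBlDr ltrDl; apply: mulr_gt0; last exact: mean_gt0_mass.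
    by rewrite subr_gt0 -[ltRHS]expR0 ltr_expR ltrN10.
  - exact: bounded_measurable_cst.
  - by apply: bounded_measurableM => //; exact: bounded_measurable_cst.
apply: (@squeeze_cvgr _ _ _ _ (cst 0) (fun J => expR n%:R * rho * rho ^+ J)).
- near=> J; apply/andP; split; first by apply: Ex_ge0 => o; exact: ler0n.
  apply: le_trans (_ : expR (- (- n%:R)) * rho ^+ J.+1 <= _); last first.
    by rewrite opprK exprS mulrA.
  apply: le_trans (chernoff (-1) (- n%:R) 1 J.+1).
  apply: le_Ex.
  + apply: (prefix_bounded_measurable_bool P tau J.+1 (fun t => arrival t J <= n)%N).
    by move=> t u tu; rewrite (eq_arrival t u).
  + apply: (prefix_bounded_measurable_bool P tau J.+1
      (fun t => - n%:R <= \sum_(i < J.+1) (-1) * (minn (t i) 1)%:R)) => t u tu.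
    by congr (_ <= _); apply: eq_bigr => i _; rewrite tu.
  + move=> o; rewrite ler_nat; case: (leqP (arrival (tau ^~ o) J) n) => // tn.
    rewrite lt0b -mulr_sumr mulN1r lerN2 -natr_sum ler_nat.
    apply: leq_trans tn.
    by apply: leq_sum => i _; exact: geq_minl.
- exact: cvg_cst.
- rewrite -[X in _ --> X](mulr0 (expR n%:R * rho)).
  by apply: cvgMl_tmp; apply: cvg_expr; rewrite ger0_norm.
Unshelve. all: by end_near. Qed.

End Tail.

Section MomentLimit.
Context {R : realType} (pi : probability nat R) (b w : nat)
  {d} {T : measurableType d} (P : probability T R)
  (tau : nat -> {RV P >-> nat}) (draw : nat -> {RV P >-> bool})
  (white : nat -> {RV P >-> nat}).
Hypothesis urnP : urn_process pi b w tau draw white.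
Hypothesis w0 : (0 < w)%N.

Lemma urn_process_iid : iid_law P tau pi.
Proof. by split; [exact: tau_law urnP|exact: tau_independent urnP]. Qed.

(** On each atom where the arrival number J comes after step n, [atom_moment] gives
the moment exactly.  The remaining atoms make up the event in the bound. *)
Lemma moment_growth_error (k n J : nat) :
  `|Ex P (fun o => (rising k (white n o))%:R)
    - (rising k w)%:R * Ex P (fun o => growth k (b + w) J (tau ^~ o) n)| <=
  ((rising k (w + n))%:R + (rising k w)%:R * n.+1%:R ^+ k) *
  Ex P (fun o => (arrival (tau ^~ o) J <= n)%N%:R).
Proof.
have bw0 : (0 < b + w)%N by rewrite addn_gt0 w0 orbT.
pose g o : R := growth k (b + w) J (tau ^~ o) n.
pose r o : R := (rising k (white n o))%:R.
pose bad o := (arrival (tau ^~ o) J <= n)%N.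
have bg : bounded_measurable g by exact: growth_bounded_measurable.
have br : bounded_measurable r.
  exact: (white_bounded_measurable _ _ _ _ _ _ _ urnP (fun x => (rising k x)%:R)).
pose D o := r o - (rising k w)%:R * g o.
have bcg : bounded_measurable (fun o => (rising k w)%:R * g o).
  by apply: bounded_measurableM => //; exact: bounded_measurable_cst.
have bD : bounded_measurable D.
  by apply: bounded_measurableD => //; exact: bounded_measurableN.
have bbad : bounded_measurable (fun o => (bad o)%:R : R).
  apply: (prefix_bounded_measurable_bool P tau J.+1 (fun t => arrival t J <= n)%N).
  by move=> t u tu; rewrite (eq_arrival t u).
pose atom c o := capped n.+1 J.+1 (tau ^~ o) == c.
have batom c : bounded_measurable (fun o => (atom c o)%:R : R).
  exact: (capped_bounded_measurable P tau _ _ (fun e => (e == c)%:R)).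
(* Truncation at n + 1 decides whether the arrival number J is after step n. *)
pose good (c : {ffun 'I_J.+1 -> 'I_n.+2}) :=
  `[< exists2 t, capped n.+1 J.+1 t = c & (n < arrival t J)%N >].
have split1 o : D o = D o * (bad o)%:R + \sum_(c | good c) D o * (atom c o)%:R.
  rewrite -mulr_sumr -mulrDr (_ : _ + _ = 1) ?mulr1// /bad.
  have [on|no] := leqP.
    rewrite big1 ?addr0// => c /asboolP[t tc nt]; rewrite /atom -tc.
    case: eqP => // ot; move: nt.
    by rewrite ltnNge -(capped_arrival _ _ _ _ _ _ ot)// on.
  rewrite (bigD1 (capped n.+1 J.+1 (tau ^~ o)))/=; last by apply/asboolP; exists (tau ^~ o).
  rewrite /atom eqxx big1 ?addr0 ?add0r// => c /andP[_].
  by rewrite eq_sym => /negbTE ->.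
have atom0 c : good c -> Ex P (fun o => D o * (atom c o)%:R) = 0.
  move=> /asboolP[t tc nt].
  have Dc o : D o * (atom c o)%:R = r o * (atom c o)%:R
      - ((rising k w)%:R * growth k (b + w) J t n) * (atom c o)%:R.
    rewrite /D mulrBl /atom; case: eqP => [oc|]; last by rewrite !mulr0.
    congr (_ - _ * _ * _); apply: eq_growth => i il.
    by apply: (capped_arrival_count n.+1); rewrite ?oc ?tc// ltnW.
  under [X in Ex _ X]eq_fun do rewrite Dc.
  rewrite ExB; first last.
  - by apply: bounded_measurableM => //; exact: bounded_measurable_cst.
  - exact: bounded_measurableM.
  rewrite ExZ// /r /atom -tc (atom_moment _ _ _ _ _ _ _ urnP w0)//.
  by rewrite subrr.
have ED : Ex P D = Ex P (fun o => D o * (bad o)%:R).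
  rewrite [LHS](congr1 (Ex P) (funext split1)) ExD; first last.
  - by apply: bounded_measurable_sum => c _; exact: bounded_measurableM.
  - exact: bounded_measurableM.
  rewrite Ex_sum; last by move=> c _; exact: bounded_measurableM.
  by rewrite [X in _ + X]big1 ?addr0.
rewrite -ExZ// -ExB// -/D ED.
apply: le_trans (le_norm_Ex _ _ _) _; first exact: bounded_measurableM.
rewrite -ExZ//; apply: le_Ex.
- by apply: bounded_measurable_norm; exact: bounded_measurableM.
- by apply: bounded_measurableM => //; exact: bounded_measurable_cst.
move=> o; rewrite normrM [X in _ * X <= _]ger0_norm//; apply: ler_wpM2r => //.
apply: le_trans (ler_normB _ _) _.
rewrite /r ger0_norm ?ler0n// ger0_norm ?mulr_ge0 ?ler0n ?growth_ge0//.
apply: lerD; first by rewrite ler_nat leq_rising// (white_le _ _ _ _ _ _ _ urnP).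
by rewrite ler_wpM2l ?ler0n// growth_le.
Qed.

Lemma moment_growth_limit (k n : nat) : (0 < mean pi)%E ->
  (rising k w)%:R * Ex P (fun o => growth k (b + w) J (tau ^~ o) n) @[J --> \oo] -->
  Ex P (fun o => (rising k (white n o))%:R : R).
Proof.
move=> mu0; apply/cvgrPdist_le => e e0.
have := arrival_tail P tau pi urn_process_iid n mu0.
pose M : R := (rising k (w + n))%:R + (rising k w)%:R * n.+1%:R ^+ k.
move=> /(@cvgMl_tmp _ _ _ _ _ M); rewrite mulr0 => /cvgrPdist_le/(_ e e0).
apply: filterS => J; rewrite sub0r normrN; apply: le_trans.
apply: le_trans (moment_growth_error k n J) _.
exact: ler_norm.
Qed.

End MomentLimit.

(** The growth product up to n does not change when the waiting times are truncated
at n + 1, so [Ex_capped] expresses its expectation through pi. *)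
Lemma Ex_growth_eq_law {R : realType} (pi : probability nat R)
  {d1} {T1 : measurableType d1} (P1 : probability T1 R) (tau1 : nat -> {RV P1 >-> nat})
  {d2} {T2 : measurableType d2} (P2 : probability T2 R) (tau2 : nat -> {RV P2 >-> nat})
  (k s J n : nat) :
  iid_law P1 tau1 pi -> iid_law P2 tau2 pi ->
  Ex P1 (fun o => growth k s J (tau1 ^~ o) n) = Ex P2 (fun o => growth k s J (tau2 ^~ o) n).
Proof.
move=> iid1 iid2.
pose ext (c : {ffun 'I_J.+1 -> 'I_n.+2}) (i : nat) : nat := c (inord i).
have E t : growth k s J t n = growth k s J (ext (capped n.+1 J.+1 t)) n :> R.
  apply: eq_growth => i il; rewrite -(arrival_count_minn J t n.+1); last exact: leqW.
  by apply: eq_arrival_count => j jJ; rewrite /ext ffunE capE inordK// leqW.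
pose F (c : {ffun 'I_J.+1 -> 'I_n.+2}) : R := growth k s J (ext c) n.
transitivity (Ex P1 (fun o => F (capped n.+1 J.+1 (tau1 ^~ o)))).
  by congr Ex; apply/funext => o; exact: E.
rewrite (Ex_capped P1 tau1 pi iid1) -(Ex_capped P2 tau2 pi iid2).
by congr Ex; apply/funext => o; rewrite /F -E.
Qed.

(** * Real sequences with summable perturbations *)

Section RealAnalysis.
Context {R : realType}.
Implicit Types (x y : R) (u e : nat -> R).

Lemma powR_expR x y : 0 < x -> x `^ y = expR (y * ln x).
Proof. by move=> x0; rewrite /powR gt_eqF. Qed.

Lemma ln_succ_ge (n : nat) : n.+2%:R^-1 <= ln (n.+2%:R / n.+1%:R) :> R.
Proof.
have -> : n.+2%:R / n.+1%:R = (n.+1%:R / n.+2%:R)^-1 :> R by rewrite invf_div.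
rewrite lnV ?posrE ?divr_gt0// lerNr.
have -> : n.+1%:R / n.+2%:R = 1 + - n.+2%:R^-1 :> R.
  have {1}-> : n.+1%:R = n.+2%:R - 1 :> R by rewrite -[n.+2%:R]natr1 addrK.
  by rewrite mulrBl mul1r divff// pnatr_eq0.
by apply: le_ln1Dx; rewrite ltrN2 invf_lt1// ltr1n.
Qed.

Lemma ln_succ_le (n : nat) : ln (n.+2%:R / n.+1%:R) <= n.+1%:R^-1 :> R.
Proof.
have -> : n.+2%:R / n.+1%:R = 1 + n.+1%:R^-1 :> R.
  by rewrite -[n.+2%:R]natr1 mulrDl mul1r divff// pnatr_eq0.
by apply: le_ln1Dx; apply: lt_trans (_ : 0 < _); rewrite ?ltrN10// invr_gt0.
Qed.

(** Comparison with the integral of x^(-1-delta), in telescoped form. *)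
Lemma sum_powR_le (delta : R) (n : nat) : 0 < delta ->
  \sum_(i < n) i.+1%:R `^ (- (1 + delta)) <= 1 + delta^-1.
Proof.
move=> d0; have dV : 0 < delta^-1 by rewrite invr_gt0.
case: n => [|n]; first by rewrite big_ord0 addr_ge0// ltW.
apply: le_trans (_ : _ <= 1 + delta^-1 * (1 - n.+1%:R `^ (- delta))) _; last first.
  by rewrite lerD2l ler_piMr ?ltW// gerBl powR_ge0.
elim: n => [|n IH]; first by rewrite big_ord1 !powR1 subrr mulr0 addr0.
rewrite big_ord_recr/=; apply: le_trans (lerD IH (lexx _)) _.
rewrite -addrA lerD2l -lerBrDl -mulrBr -ler_pdivrMl// invrK.
rewrite [leRHS](_ : _ = n.+1%:R `^ (- delta) - n.+2%:R `^ (- delta)); last by ring.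
have y0 : (0 : R) < n.+2%:R by [].
have -> : n.+1%:R `^ (- delta) = n.+2%:R `^ (- delta) * expR (delta * ln (n.+2%:R / n.+1%:R)) :> R.
  rewrite !powR_expR// -expRD ln_div ?posrE//; congr expR; ring.
have -> : n.+2%:R `^ (- (1 + delta)) = n.+2%:R `^ (- delta) * n.+2%:R^-1 :> R.
  rewrite opprD addrC powRD ?powR_inv1//.
  by rewrite pnatr_eq0 implybT.
rewrite -[X in _ - X]mulr1 -mulrBr mulrCA ler_wpM2l ?powR_ge0//.
rewrite lerBrDl; apply: le_trans (expR_ge1Dx _).
by rewrite lerD2l ler_pM2l// ln_succ_ge.
Qed.

Lemma sum_inv_ge (n : nat) : ln n.+1%:R <= \sum_(i < n) i.+1%:R^-1 :> R.
Proof.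
elim: n => [|n IH]; first by rewrite big_ord0 ln1.
rewrite big_ord_recr/=; apply: le_trans (lerD IH (ln_succ_le n)).
by rewrite ln_div ?posrE// addrC subrK.
Qed.

(** Discrete Gronwall inequality: the recursion bounds u + 1 by a multiple of
exp (e_0 + e_1 + ...), and then the increments of u are absolutely summable. *)
Lemma perturbation_cvg u e (E : R) :
  (forall n, 0 <= u n) -> (forall n, 0 <= e n) ->
  (forall n, \sum_(i < n) e i <= E) ->
  (forall n, `|u n.+1 - u n| <= e n * (u n + 1)) -> cvgn u.
Proof.
move=> u0 e0 eE ue.
have grow n : u n + 1 <= (u 0%N + 1) * expR (\sum_(i < n) e i).
  elim: n => [|n IH]; first by rewrite big_ord0 expR0 mulr1.
  rewrite big_ord_recr/= expRD mulrA.
  have : u n.+1 + 1 <= (u n + 1) * (1 + e n).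
    by have := ler_normlP _ _ (ue n); case; lra.
  move/le_trans; apply; apply: ler_pM => //; rewrite ?addr_ge0//.
  exact: expR_ge1Dx.
pose H := (u 0%N + 1) * expR E.
have uH n : u n + 1 <= H.
  apply: le_trans (grow n) _; rewrite ler_pM2l ?ler_expR//.
  by rewrite ltr_wpDl.
have -> : u = (fun n => u 0%N + series (telescope u) n).
  by apply/funext => n; exact: eq_sum_telescope.
apply: is_cvgD; first exact: is_cvg_cst.
apply: normed_cvg; apply: nondecreasing_is_cvgn.
  by apply: nondecreasing_series => n _ _; exact: normr_ge0.
exists (H * E) => _ [n _ <-] /=.
rewrite seriesEnat/= big_mkord.
apply: le_trans (_ : \sum_(i < n) H * e i <= _); last first.
  rewrite -mulr_sumr ler_wpM2l//.
  by apply: le_trans (uH 0%N); rewrite addr_ge0.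
apply: ler_sum => i _; rewrite /telescope; apply: le_trans (ue i) _.
by rewrite mulrC ler_wpM2r.
Qed.

(** log (1 + x) >= x / (1 + x) >= x - x^2. *)
Lemma one_plus_ge_expR x : 0 <= x -> expR (x - x ^+ 2) <= 1 + x.
Proof.
move=> x0; have x1 : 0 < 1 + x by rewrite ltr_pwDl.
apply: le_trans (_ : expR (x / (1 + x)) <= _).
  rewrite ler_expR ler_pdivlMr//.
  have : 0 <= x * x * x by rewrite !mulr_ge0.
  by rewrite expr2; lra.
rewrite -[leLHS]invrK -expRN -[leRHS]invrK lef_pV2 ?posrE ?invr_gt0// ?expR_gt0//.
apply: le_trans (expR_ge1Dx _).
by rewrite [leRHS](_ : _ = (1 + x)^-1)//; field; rewrite gt_eqF.
Qed.

(** The ratio of consecutive values of n^beta is 1 + beta / n up to O(1 / n^2), so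
normalising by n^beta keeps the errors summable. *)
Lemma normalisation_step (beta : R) (n : nat) : 0 <= beta ->
  `|(n.+1%:R / n.+2%:R) `^ beta * (1 + beta / n.+1%:R) - 1| <=
  (beta ^+ 2 + beta * expR beta) * n.+1%:R ^- 2.
Proof.
move=> b0; pose x : R := n.+1%:R^-1.
have x0 : 0 < x by rewrite invr_gt0.
have x1 : x <= 1 by rewrite invf_le1// ler1n.
rewrite -exprVn -/x.
pose l := ln (n.+2%:R / n.+1%:R) : R.
have lx : l <= x by exact: ln_succ_le.
have xl : x - x ^+ 2 <= l.
  apply: le_trans (ln_succ_ge n).
  rewrite -(ler_pM2r (ltr0Sn R n.+1)) mulVf//.
  have -> : n.+2%:R = x^-1 + 1 :> R by rewrite invrK natr1.
  rewrite [leLHS](_ : _ = 1 - x ^+ 2); last by field; rewrite gt_eqF.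
  by rewrite gerBl sqr_ge0.
have -> : (n.+1%:R / n.+2%:R) `^ beta = expR (- (beta * l)) :> R.
  rewrite powR_expR ?divr_gt0// -(invf_div n.+2%:R) lnV ?posrE ?divr_gt0//.
  by rewrite mulrN.
have bx0 : 0 <= beta * x by rewrite mulr_ge0// ltW.
have bx1 : 0 < 1 + beta * x by rewrite ltr_pwDl.
have x2 : 0 <= x ^+ 2 by exact: sqr_ge0.
rewrite ler_norml; apply/andP; split.
  have : 1 - (beta * x) ^+ 2 <= expR (- (beta * l)) * (1 + beta * x).
    rewrite [leLHS](_ : _ = (1 + - (beta * x)) * (1 + beta * x)); last by ring.
    rewrite ler_pM2r//; apply: le_trans (expR_ge1Dx _) _.
    by rewrite ler_expR lerN2 ler_wpM2l.
  have : 0 <= beta * expR beta * x ^+ 2 by rewrite mulr_ge0// mulr_ge0// expR_ge0.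
  by rewrite exprMn; lra.
have : expR (- (beta * l)) * (1 + beta * x) <= expR (beta * x ^+ 2).
  apply: le_trans (ler_wpM2l (expR_ge0 _) (expR_ge1Dx _)) _.
  rewrite -expRD ler_expR.
  have := ler_wpM2l b0 xl; lra.
have : expR (beta * x ^+ 2) - 1 <= beta * x ^+ 2 * expR beta.
  have e0 : 0 <= beta * x ^+ 2 by rewrite mulr_ge0.
  apply: le_trans (_ : beta * x ^+ 2 * expR (beta * x ^+ 2) <= _).
    have := expR_ge1Dx (- (beta * x ^+ 2)).
    move=> /(ler_wpM2r (expR_ge0 (beta * x ^+ 2))).
    by rewrite -expRD addNr expR0; lra.
  rewrite ler_wpM2l// ler_expR ler_piMr// expr_le1// ltW//.
have : 0 <= beta ^+ 2 * x ^+ 2 by rewrite mulr_ge0 ?sqr_ge0.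
lra.
Qed.

End RealAnalysis.

(** * Asymptotics of the growth product under concentration *)

(** Written for the step n + 1, to avoid the step 0.  The bound for B is tuned to
kappa, since on B the growth product may exceed its typical size by the factor
n^kappa.  The threshold J0 depends on n, the constants do not. *)
Definition concentrated {R : realType} {d} {T : measurableType d}
    (P : probability T R) (tau : nat -> {RV P >-> nat}) (s : nat)
    (alpha kappa delta C : R) : Prop :=
  forall n, exists J0, forall J, (J0 <= J)%N -> exists B : T -> bool,
    [/\ measurable [set o | B o],
        Ex P (fun o => (B o)%:R) <= C * n.+1%:R `^ (- (kappa + delta)) &
        forall o, ~~ B o ->
          `|(s + n.+1 + arrival_count J (tau ^~ o) n.+1)%:R^-1 - alpha / n.+1%:R|
          <= C * n.+1%:R `^ (- (1 + delta))].

Section Core.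
Context {R : realType} {d} {T : measurableType d} (P : probability T R)
  (tau : nat -> {RV P >-> nat}) (k s : nat) (alpha delta C : R).
Hypotheses (s0 : (0 < s)%N) (alpha0 : 0 < alpha) (alpha1 : alpha <= 1)
  (delta0 : 0 < delta) (delta1 : delta <= 1) (C0 : 0 <= C).
Let kappa := k%:R * (1 - alpha).
Let beta := k%:R * alpha.
Hypothesis conc : concentrated P tau s alpha kappa delta C.

Let V J n o : R := (s + n + arrival_count J (tau ^~ o) n)%:R^-1.
Let G J n o : R := growth k s J (tau ^~ o) n.
Let dist J n o := `|V J n.+1 o - alpha / n.+1%:R|.

Let V_ge0 J n o : 0 <= V J n o. Proof. by rewrite invr_ge0. Qed.

Let V_le J n o : V J n.+1 o <= n.+1%:R^-1.
Proof.
by rewrite lef_pV2 ?posrE ?ltr0n ?ler_nat -?addnA ?addSn ?addnS// ltnS addnCA leq_addr.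
Qed.

Let bV J n : bounded_measurable (V J n).
Proof.
apply: (prefix_bounded_measurable P tau J
  (fun t => (s + n + arrival_count J t n)%:R^-1) 1) => [t u tu|t].
  by rewrite (eq_arrival_count J t u).
by rewrite ger0_norm ?invr_ge0// invf_le1 ?ler1n ?ltr0n -addnA addn_gt0 s0.
Qed.

Let bG J n : bounded_measurable (G J n).
Proof. exact: growth_bounded_measurable. Qed.

Let bdist J n : bounded_measurable (dist J n).
Proof.
apply: bounded_measurable_norm; apply: bounded_measurableD => //.
exact: bounded_measurable_cst.
Qed.

Let GS J n o : G J n.+1 o = G J n o * (1 + k%:R * V J n o).
Proof. exact: growthS. Qed.

Let dist_le J n o : dist J n o <= n.+1%:R^-1.
Proof.
have := V_le J n o; have := V_ge0 J n.+1 o.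
have n0 : (0 : R) < n.+1%:R^-1 by rewrite invr_gt0.
have : 0 <= alpha / n.+1%:R by rewrite divr_ge0// ltW.
have : alpha / n.+1%:R <= n.+1%:R^-1 by rewrite ler_piMl// ltW.
rewrite /dist; set a := alpha / _; set v := V _ _ _; set y := n.+1%:R^-1 => ay a0 v0 vy.
by rewrite ler_norml; apply/andP; split; lra.
Qed.

Let kappa0 : 0 <= kappa.
Proof. by rewrite mulr_ge0// subr_ge0. Qed.

Let pw n x : (0 : R) < n.+1%:R `^ x.
Proof. by rewrite powR_gt0. Qed.

Let dist_split J n o (B : T -> bool) :
  (~~ B o -> dist J n o <= C * n.+1%:R `^ (- (1 + delta))) ->
  dist J n o <= C * n.+1%:R `^ (- (1 + delta)) + n.+1%:R^-1 * (B o)%:R.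
Proof.
case: (B o) => [_|/(_ isT)]; last by rewrite mulr0 addr0.
rewrite mulr1; apply: le_trans (dist_le J n o) _.
by rewrite lerDr mulr_ge0// ltW.
Qed.

(** The exceptional event B contributes at most (n + 1)^k P(B) / n, and
n^k n^(-1) n^(-(kappa + delta)) = n^(beta - 1 - delta) because
k - kappa = beta. *)
Lemma step_error n : exists J0, forall J, (J0 <= J)%N ->
  `|Ex P (G J n.+2) - (1 + beta / n.+1%:R) * Ex P (G J n.+1)| <=
  k%:R * (C + C * 2 ^+ k) * n.+1%:R `^ (- (1 + delta)) *
    (Ex P (G J n.+1) + n.+1%:R `^ beta).
Proof.
have [J0 concn] := conc n; exists J0 => J /concn[B [mB PB offB]].
have bB : bounded_measurable (fun o => (B o)%:R : R) by exact: bounded_measurable_indic.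
have cst c : bounded_measurable (fun _ : T => c : R) by exact: bounded_measurable_cst.
have bdev : bounded_measurable (fun o => V J n.+1 o - alpha / n.+1%:R).
  exact: bounded_measurableD.
have E o : G J n.+2 o - (1 + beta / n.+1%:R) * G J n.+1 o =
    k%:R * (G J n.+1 o * (V J n.+1 o - alpha / n.+1%:R)).
  by rewrite GS /beta; ring.
rewrite -ExZ// -ExB//; last exact: bounded_measurableM.
under [X in Ex _ X]eq_fun do rewrite E.
rewrite ExZ; last exact: bounded_measurableM.
rewrite normrM (ger0_norm (ler0n R k)).
rewrite -!mulrA ler_wpM2l//.
apply: le_trans (le_norm_Ex _ _ _) _; first exact: bounded_measurableM.
apply: le_trans (_ : Ex P (fun o => C * n.+1%:R `^ (- (1 + delta)) * G J n.+1 o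
    + n.+1%:R^-1 * (2 * n.+1%:R) ^+ k * (B o)%:R) <= _).
  apply: le_Ex.
  - by apply: bounded_measurable_norm; exact: bounded_measurableM.
  - by apply: bounded_measurableD; exact: bounded_measurableM.
  move=> o; have g0 : 0 <= G J n.+1 o by exact: growth_ge0.
  rewrite normrM (ger0_norm g0).
  apply: le_trans (ler_wpM2l g0 (dist_split J n o B (offB o))) _.
  rewrite mulrDr; apply: lerD; first by rewrite mulrC.
  rewrite [leRHS](_ : _ = (2 * n.+1%:R) ^+ k * (n.+1%:R^-1 * (B o)%:R)); last by ring.
  rewrite ler_wpM2r ?mulr_ge0 ?invr_ge0//.
  apply: le_trans (growth_le _ _ _ _ _ s0) _.
  by rewrite lerXn2r ?nnegrE// -natrM ler_nat; lia.
rewrite ExD; try exact: bounded_measurableM.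
rewrite ExZ// ExZ//.
rewrite !mulrA.
set g := Ex P (G J n.+1); set q := n.+1%:R `^ (- (1 + delta)); set nb := n.+1%:R `^ beta.
have g0 : 0 <= g by apply: Ex_ge0 => o; exact: growth_ge0.
have q0 : 0 < q by exact: pw.
have nb0 : 0 < nb by exact: pw.
have key : n.+1%:R^-1 * (2 * n.+1%:R) ^+ k * Ex P (fun o => (B o)%:R) <= C * 2 ^+ k * q * nb.
  have E1 : q * nb = n.+1%:R ^+ k * n.+1%:R^-1 * n.+1%:R `^ (- (kappa + delta)) :> R.
    rewrite /q /nb -powR_mulrn// -powR_inv1// -!powRD ?pnatr_eq0 ?implybT//.
    by congr powR; rewrite /kappa /beta; ring.
  rewrite -[leRHS]mulrA E1 exprMn.
  have c0 : 0 <= n.+1%:R^-1 * (2 ^+ k * n.+1%:R ^+ k) :> R.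
    by rewrite mulr_ge0 ?invr_ge0// mulr_ge0// exprn_ge0.
  apply: le_trans (ler_wpM2l c0 PB) _.
  by rewrite [leLHS](_ : _ = C * 2 ^+ k *
    (n.+1%:R ^+ k / n.+1%:R * n.+1%:R `^ (- (kappa + delta))))//; ring.
have : 0 <= C * 2 ^+ k * q * g by rewrite !mulr_ge0 ?exprn_ge0// ltW.
have : 0 <= C * q * nb by rewrite !mulr_ge0// ltW.
move: key; set X := _ * Ex P _; set c2 := 2 ^+ k; lra.
Qed.

Lemma Ex_dist_le n : exists J0, forall J, (J0 <= J)%N ->
  Ex P (dist J n) <= 2 * C * n.+1%:R `^ (- (1 + delta)).
Proof.
have [J0 concn] := conc n; exists J0 => J /concn[B [mB PB offB]].
have bB : bounded_measurable (fun o => (B o)%:R : R) by exact: bounded_measurable_indic.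
have cst c : bounded_measurable (fun _ : T => c : R) by exact: bounded_measurable_cst.
apply: le_trans (_ : Ex P (fun o => C * n.+1%:R `^ (- (1 + delta))
    + n.+1%:R^-1 * (B o)%:R) <= _).
  apply: le_Ex => // [|o]; last exact: dist_split (offB o).
  by apply: bounded_measurableD => //; exact: bounded_measurableM.
rewrite ExD//; last exact: bounded_measurableM.
rewrite Ex_cst ExZ// [leRHS](_ : _ = C * n.+1%:R `^ (- (1 + delta))
  + C * n.+1%:R `^ (- (1 + delta))); last by ring.
rewrite lerD2l.
have n0 : (0 : R) <= n.+1%:R^-1 by rewrite invr_ge0.
apply: le_trans (ler_wpM2l n0 PB) _; rewrite mulrCA ler_wpM2l//.
rewrite -powR_inv1// -powRD ?pnatr_eq0 ?implybT// ler_powR ?ler1n//.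
by have := kappa0; lra.
Qed.

(** Jensen's inequality for exp.  The lower bound Y of log G_n replaces
log (1 + x) by x - x^2, and its expectation is beta log n up to a bounded error. *)
Lemma growth_lower_bound : exists2 c : R, 0 < c &
  forall n, exists J0, forall J, (J0 <= J)%N -> c * n.+1%:R `^ beta <= Ex P (G J n.+1).
Proof.
pose C2 := k%:R * (2 * C) + k%:R ^+ 2.
have C20 : 0 <= C2 by rewrite addr_ge0 ?mulr_ge0 ?exprn_ge0.
pose eps i : R := i.+1%:R `^ (- (1 + delta)).
(* The sum of n^(-(1 + delta)) is at most 1 + 1 / delta. *)
exists (expR (- (C2 * (1 + delta^-1)))); first exact: expR_gt0.
move=> n.
have [J0 J0P] : exists J0, forall J, (J0 <= J)%N -> forall i, (i < n)%N ->
    Ex P (dist J i) <= 2 * C * eps i.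
  elim: n => [|n [J1 J1P]]; first by exists 0%N.
  have [J2 J2P] := Ex_dist_le n.
  exists (maxn J1 J2) => J; rewrite geq_max => /andP[J1J J2J] i.
  by rewrite ltnS leq_eqVlt => /predU1P[->|]; [exact: J2P|exact: J1P].
exists J0 => J /J0P distP {J0P}.
have cst c : bounded_measurable (fun _ : T => c : R) by exact: bounded_measurable_cst.
(* By [one_plus_ge_expR], y i is below the logarithm of the factor 1 + k V. *)
pose y i o : R := beta / i.+1%:R - k%:R * dist J i o - k%:R ^+ 2 * i.+1%:R ^- 2.
have byi i : bounded_measurable (y i).
  apply: bounded_measurableD => //; apply: bounded_measurableD => //.
  by apply: bounded_measurableN; exact: bounded_measurableM.
pose Y o := \sum_(i < n) y i o.
have bY : bounded_measurable Y by apply: bounded_measurable_sum => i _.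
have GY o : expR (Y o) <= G J n.+1 o.
  rewrite /G /growth big_ord_recl/= expR_sum -[leLHS]mul1r.
  apply: ler_pM => //; first by apply: prodr_ge0 => i _; exact: expR_ge0.
    by rewrite lerDl divr_ge0.
  apply: ler_prod => i _; rewrite expR_ge0/=.
  have := one_plus_ge_expR (k%:R * V J (bump 0 i) o).
  rewrite mulr_ge0// => /(_ isT); apply: le_trans; rewrite ler_expR.
  rewrite /bump/= add1n /y.
  have v1 := V_le J i o.
  have d1 : alpha / i.+1%:R - V J i.+1 o <= dist J i o.
    by rewrite /dist distrC ler_norm.
  have : k%:R * (alpha / i.+1%:R - V J i.+1 o) <= k%:R * dist J i o :> R.
    by rewrite ler_wpM2l.
  have : (k%:R * V J i.+1 o) ^+ 2 <= k%:R ^+ 2 * i.+1%:R ^- 2 :> R.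
    by rewrite exprMn ler_wpM2l ?exprn_ge0// -exprVn lerXn2r ?nnegrE ?invr_ge0.
  rewrite /beta; set x2 := i.+1%:R ^- 2; set x1 := i.+1%:R^-1.
  by set v := V _ _ _; set D := dist _ _ _; lra.
pose m := beta * ln n.+1%:R - C2 * (1 + delta^-1).
have EY : m <= Ex P Y.
  rewrite /Y Ex_sum//.
  have b0 : 0 <= beta by rewrite mulr_ge0// ltW.
  apply: le_trans (_ : beta * (\sum_(i < n) i.+1%:R^-1) - C2 * \sum_(i < n) eps i <= _).
    apply: lerB; first by rewrite ler_wpM2l ?sum_inv_ge.
    by rewrite ler_wpM2l// sum_powR_le.
  rewrite !mulr_sumr -sumrB; apply: ler_sum => i _.
  have e2 : i.+1%:R ^- 2 <= eps i.
    rewrite /eps powRN lef_pV2 ?posrE ?exprn_gt0 ?powR_gt0//.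
    by rewrite -powR_mulrn// ler_powR ?ler1n//; have := delta1; lra.
  have -> : Ex P (y i) = beta / i.+1%:R - k%:R * Ex P (dist J i) - k%:R ^+ 2 * i.+1%:R ^- 2.
    rewrite /y ExB// ?ExB ?Ex_cst ?ExZ//; try exact: bounded_measurableM.
    by apply: bounded_measurableD => //; apply: bounded_measurableN; exact: bounded_measurableM.
  have := distP i (ltn_ord i) => di.
  have : k%:R * Ex P (dist J i) <= k%:R * (2 * C * eps i) by rewrite ler_wpM2l.
  have : k%:R ^+ 2 * i.+1%:R ^- 2 <= k%:R ^+ 2 * eps i by rewrite ler_wpM2l ?exprn_ge0.
  rewrite /C2; set x2 := i.+1%:R ^- 2; set x1 := i.+1%:R^-1.
  by set D := Ex P _; set ei := eps _; lra.
have -> : expR (- (C2 * (1 + delta^-1))) * n.+1%:R `^ beta = expR m.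
  by rewrite powR_expR// -expRD addrC.
(* The tangent of exp at m lies below exp. *)
apply: le_trans (_ : Ex P (fun o => expR m * (1 + (Y o - m))) <= _); last first.
  apply: le_Ex => // [|o].
    apply: bounded_measurableM => //; apply: bounded_measurableD => //.
    exact: bounded_measurableD.
  apply: le_trans (GY o).
  have -> : expR (Y o) = expR m * expR (Y o - m) by rewrite -expRD addrC subrK.
  by rewrite ler_wpM2l ?expR_ge0// expR_ge1Dx.
rewrite ExZ; last first.
  by apply: bounded_measurableD => //; exact: bounded_measurableD.
rewrite ExD//; last exact: bounded_measurableD.
rewrite Ex_cst ExB// Ex_cst ler_peMr ?expR_ge0//.
by rewrite lerDl subr_ge0.
Qed.

(** The estimates for finite J hold with constants independent of J, hence for the
limits gam n as well. *)
Lemma growth_cvg (gam : nat -> R) :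
  (forall n, Ex P (G J n) @[J --> \oo] --> gam n) ->
  exists2 m : R, 0 < m & gam n / n%:R `^ beta @[n --> \oo] --> m.
Proof.
move=> gamP.
have gam0 n : 0 <= gam n.
  have /cvg_lim <- // := gamP n.
  apply: limr_ge; first by apply/cvg_ex; exists (gam n); exact: gamP.
  by apply: nearW => J; apply: Ex_ge0 => o; exact: growth_ge0.
have b0 : 0 <= beta by rewrite mulr_ge0// ltW.
pose C1 := k%:R * (C + C * 2 ^+ k).
have C10 : 0 <= C1 by rewrite mulr_ge0// addr_ge0// mulr_ge0// exprn_ge0.
have step n : `|gam n.+2 - (1 + beta / n.+1%:R) * gam n.+1| <=
    C1 * n.+1%:R `^ (- (1 + delta)) * (gam n.+1 + n.+1%:R `^ beta).
  have [J0 J0P] := step_error n.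
  apply: (@ler_cvg_to _ \oo _ _ 
    (fun J => `|Ex P (G J n.+2) - (1 + beta / n.+1%:R) * Ex P (G J n.+1)|)
    (fun J => C1 * n.+1%:R `^ (- (1 + delta)) * (Ex P (G J n.+1) + n.+1%:R `^ beta))).
  - apply: cvg_norm; apply: cvgB; first exact: gamP.
    by apply: cvgMl_tmp; exact: gamP.
  - by apply: cvgMl_tmp; apply: cvgD; [exact: gamP|exact: cvg_cst].
  - by exists J0 => //= J; exact: J0P.
have [c c0 cP] := growth_lower_bound.
have lower n : c * n.+1%:R `^ beta <= gam n.+1.
  have [J0 J0P] := cP n.
  apply: (@ler_cvg_to _ \oo _ _ (cst (c * n.+1%:R `^ beta)) (fun J => Ex P (G J n.+1))).
  - exact: cvg_cst.
  - exact: gamP.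
  - by exists J0 => //= J; exact: J0P.
pose u n := gam n.+1 / n.+1%:R `^ beta.
have cu n : c <= u n by rewrite /u ler_pdivlMr.
pose C3 := beta ^+ 2 + beta * expR beta.
have C30 : 0 <= C3 by rewrite addr_ge0 ?exprn_ge0// mulr_ge0// expR_ge0.
pose e n : R := (C1 + C3) * n.+1%:R `^ (- (1 + delta)).
have /cvg_ex[m um] : cvgn u.
  apply: (@perturbation_cvg _ u e ((C1 + C3) * (1 + delta^-1))).
  - by move=> n; rewrite divr_ge0// ltW.
  - by move=> n; rewrite /e; apply: mulr_ge0; [exact: addr_ge0|exact: powR_ge0].
  - move=> n; rewrite /e -mulr_sumr; apply: ler_wpM2l; first exact: addr_ge0.
    exact: sum_powR_le.
  move=> n.
  pose th : R := (n.+1%:R / n.+2%:R) `^ beta.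
  have th1 : th <= 1.
    apply: le_trans (_ : 1 `^ beta <= _); last by rewrite powR1.
    rewrite ge0_ler_powR ?nnegrE ?divr_ge0//.
    by rewrite ler_pdivrMr// mul1r ler_nat.
  have thE : n.+1%:R `^ beta = th * n.+2%:R `^ beta.
    by rewrite -powRM ?divr_ge0// divfK ?pnatr_eq0.
  have th0 : 0 < th by rewrite powR_gt0 ?divr_gt0.
  have un : 0 <= u n by rewrite divr_ge0// ltW.
  have -> : u n.+1 - u n =
      (gam n.+2 - (1 + beta / n.+1%:R) * gam n.+1) / n.+2%:R `^ beta
      + u n * (th * (1 + beta / n.+1%:R) - 1).
    rewrite /u thE; field.
    by rewrite !gt_eqF// ?pw// ltr0n.
  apply: le_trans (ler_normD _ _) _.
  rewrite [X in X + _]normrM [X in _ + X]normrM (ger0_norm un) normfV (ger0_norm (ltW (pw n.+1 beta))).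
  have A : `|gam n.+2 - (1 + beta / n.+1%:R) * gam n.+1| / n.+2%:R `^ beta <=
      C1 * n.+1%:R `^ (- (1 + delta)) * (u n + 1).
    rewrite ler_pdivrMr//; apply: le_trans (step n) _.
    have -> : gam n.+1 + n.+1%:R `^ beta = (u n + 1) * n.+1%:R `^ beta.
      by rewrite /u mulrDl mul1r divfK// gt_eqF.
    rewrite -[leRHS]mulrA; apply: ler_wpM2l; first by rewrite mulr_ge0// powR_ge0.
    by apply: ler_wpM2l; [exact: addr_ge0|rewrite thE ler_piMl// powR_ge0].
  have Bd : u n * `|th * (1 + beta / n.+1%:R) - 1| <=
      C3 * n.+1%:R `^ (- (1 + delta)) * (u n + 1).
    rewrite mulrC; apply: ler_pM => //; last by rewrite lerDl.
    apply: le_trans (normalisation_step _ _ b0) _.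
    rewrite ler_wpM2l// powRN lef_pV2 ?posrE ?exprn_gt0 ?powR_gt0//.
    by rewrite -powR_mulrn// ler_powR ?ler1n//; have := delta1; lra.
  by apply: le_trans (lerD A Bd) _; rewrite /e; lra.
exists m.
  apply: lt_le_trans c0 _.
  have /cvg_lim <- // := um.
  apply: limr_ge; first by apply/cvg_ex; exists m.
  exact: nearW.
by rewrite -(cvg_shiftS).
Qed.

End Core.

(** * Concentration for heavy-tailed waiting times *)

Section Concentration.
Context {R : realType} {d} {T : measurableType d} (P : probability T R)
  (tau : nat -> {RV P >-> nat}) (pi : probability nat R) (s : nat).
Hypothesis iid : iid_law P tau pi.

(** With N the number of balls, 1 / N - alpha / n = alpha (n / alpha - N) / (n N),
and N >= n. *)
Lemma inv_total_dist (alpha D delta : R) (n c : nat) : 0 < alpha -> alpha <= 1 ->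
  `|(s + n.+1 + c)%:R - n.+1%:R / alpha| <= D * n.+1%:R `^ (1 - delta) ->
  `|(s + n.+1 + c)%:R^-1 - alpha / n.+1%:R| <= D * n.+1%:R `^ (- (1 + delta)).
Proof.
move=> a0 a1 ND; set N : R := (s + n.+1 + c)%:R.
have n0 : (0 : R) < n.+1%:R by [].
have nN : n.+1%:R <= N by rewrite ler_nat -addnA addnCA leq_addr.
have N0 : 0 < N by exact: lt_le_trans nN.
have -> : N^-1 - alpha / n.+1%:R = - (N - n.+1%:R / alpha) * (alpha / (N * n.+1%:R)).
  by field; rewrite !gt_eqF.
rewrite normrM normrN [X in _ * X]ger0_norm; last first.
  by rewrite divr_ge0 ?mulr_ge0// ltW.
have -> : D * n.+1%:R `^ (- (1 + delta)) = D * n.+1%:R `^ (1 - delta) * (n.+1%:R ^- 2).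
  rewrite -mulrA -powR_mulrn// -powRN -powRD ?pnatr_eq0 ?implybT//.
  by congr (_ * powR _ _); ring.
apply: ler_pM => //; first by rewrite divr_ge0 ?mulr_ge0// ltW.
rewrite ler_pdivrMr ?mulr_gt0// expr2 invfM mulrA [X in _ <= X](_ : _ = N / n.+1%:R).
  by apply: le_trans a1 _; rewrite ler_pdivlMr// mul1r.
by field; rewrite gt_eqF.
Qed.

(** For the finitely many small n the whole space is an admissible exceptional
event, once the constant is large. *)
Lemma concentrated_eventually (alpha kappa delta C : R) (n0 : nat) :
  0 < alpha -> alpha <= 1 -> 0 <= kappa -> 0 < delta ->
  (forall n, (n0 <= n)%N -> exists J0, forall J, (J0 <= J)%N -> exists B : T -> bool,
    [/\ measurable [set o | B o],
        Ex P (fun o => (B o)%:R) <= C * n.+1%:R `^ (- (kappa + delta)) &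
        forall o, ~~ B o ->
          `|(s + n.+1 + arrival_count J (tau ^~ o) n.+1)%:R - n.+1%:R / alpha|
          <= C * n.+1%:R `^ (1 - delta)]) ->
  exists2 C', 0 <= C' & concentrated P tau s alpha kappa delta C'.
Proof.
move=> a0 a1 k0 d0 H.
have pw n x : (0 : R) < n.+1%:R `^ x by rewrite powR_gt0.
pose C' := Num.max C (n0.+1%:R `^ (kappa + delta)).
exists C'; first by rewrite le_max powR_ge0 orbT.
move=> n; have [n0n|nn0] := leqP n0 n.
  have [J0 HJ] := H n n0n; exists J0 => J /HJ[B [mB PB offB]]; exists B; split => //.
    by apply: le_trans PB _; rewrite ler_wpM2r ?le_max ?lexx// ltW.
  move=> o /offB/(inv_total_dist _ _ _ _ _ a0 a1)/le_trans; apply.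
  by rewrite ler_wpM2r ?le_max ?lexx// ltW.
exists 0%N => J _; exists (fun=> true); split => //.
- by rewrite (_ : [set o : T | true] = setT)//; exact/seteqP.
- rewrite /= Ex_cst powRN ler_pdivlMr ?powR_gt0// mul1r.
  rewrite /C' le_max; apply/orP; right.
  apply: ge0_ler_powR; rewrite ?nnegrE//; first by rewrite addr_ge0// ltW.
  by rewrite ler_nat ltnS ltnW.
Qed.

Lemma arrival_measurable (n h : nat) :
  bounded_measurable (fun o => (n < arrival (tau ^~ o) h)%N%:R : R) /\
  bounded_measurable (fun o => (arrival (tau ^~ o) h <= n)%N%:R : R).
Proof.
split.
- apply: (prefix_bounded_measurable_bool P tau h.+1 (fun t => n < arrival t h)%N).
  by move=> t u tu; rewrite (eq_arrival t u).
- apply: (prefix_bounded_measurable_bool P tau h.+1 (fun t => arrival t h <= n)%N).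
  by move=> t u tu; rewrite (eq_arrival t u).
Qed.

Lemma prefix_measurable_set (J : nat) (F : (nat -> nat) -> bool) :
  (forall t u, (forall i, (i < J)%N -> t i = u i) -> F t = F u) ->
  measurable [set o | F (tau ^~ o)].
Proof.
move=> FJ.
have /(_ measurableT [set true] I) := prefix_measurable
    (fun i => tau i : T -> nat) J F (fun i k _ => measurable_RV_fiber P tau i k) FJ.
by rewrite setTI.
Qed.

(** All of the first h + 1 waiting times must be at most n, and
(1 - P(tau > n))^(h+1) <= exp (- (h + 1) P(tau > n)). *)
Lemma early_arrival_le (n h : nat) :
  Ex P (fun o => (arrival (tau ^~ o) h <= n)%N%:R) <=
  expR (- (h.+1%:R * Ex pi (fun t => (n < t)%N%:R))).
Proof.
pose f (v : nat) : R := (v <= n)%N%:R.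
have bf : @bounded_measurable R _ nat (fun t => (n < t)%N%:R) by exact: nat_bounded_measurable_bool.
apply: le_trans (_ : Ex P (fun o => \prod_(i < h.+1) f (minn (tau i o) n.+1)) <= _).
  apply: le_Ex; first exact: (arrival_measurable n h).2.
    apply: (prefix_bounded_measurable P tau h.+1
      (fun t => \prod_(i < h.+1) f (minn (t i) n.+1)) 1) => [t u tu|t].
      by apply: eq_bigr => i _; rewrite tu.
    rewrite normr_prod; apply: prodr_ile1 => i _.
    by rewrite normr_ge0 /f; case: leqP => _; rewrite ?normr1 ?normr0 ?lexx ?ler01.
  move=> o; case: leqP => [tn|_] /=; last by apply: prodr_ge0 => i _; exact: ler0n.
  rewrite big1// => i _; rewrite /f (_ : (_ <= n)%N = true)//.
  rewrite geq_min; apply/orP; left; apply: leq_trans tn.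
  by rewrite /arrival (bigD1 i)//= leq_addr.
rewrite (Ex_prod_capped P tau pi iid).
have -> : Ex pi (fun t => f (minn t n.+1)) = 1 - Ex pi (fun t => (n < t)%N%:R).
  rewrite -[X in X - _](Ex_cst pi 1) -ExB//; last exact: bounded_measurable_cst.
  congr Ex; apply/funext => t; rewrite /f geq_min ltnn orbF ltnNge.
  by case: (_ <= _)%N; rewrite ?subr0 ?subrr.
rewrite -mulrN expRM_natl lerXn2r ?nnegrE ?expR_ge0//; last exact: expR_ge1Dx.
rewrite subr_ge0 -[leRHS](Ex_cst pi 1); apply: le_Ex => //.
  exact: bounded_measurable_cst.
by move=> t; case: (_ < _)%N.
Qed.

(** With h of order n^(1 - eps/2) the exponent in [early_arrival_le] is at least
C n^(eps/2), and exp (- y) <= 1 / y already suffices since kappa = 0. *)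
Lemma concentrated_heavy_tail (eps C : R) (n0 : nat) :
  0 < eps -> eps <= 1 -> 0 < C -> (0 < s)%N ->
  (forall n, (n0 <= n)%N ->
     C * n%:R `^ (- (1 - eps)) <= Ex pi (fun t => (n < t)%N%:R)) ->
  exists2 C', 0 <= C' & concentrated P tau s 1 0 (eps / 2) C'.
Proof.
move=> e0 e1 C0 s0 tail.
have d0 : 0 < eps / 2 by rewrite divr_gt0.
pose C1 : R := Num.max C^-1 (s.+1%:R).
apply: (@concentrated_eventually 1 0 (eps / 2) C1 n0) => // n n0n.
pose x : R := n.+1%:R `^ (1 - eps / 2).
have x0 : 0 <= x by exact: powR_ge0.
have x1 : 1 <= x.
  rewrite -[leLHS](powRr0 n.+1%:R) ler_powR ?ler1n//; lra.
pose h := Num.truncn x.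
exists 0%N => J _; exists (fun o => arrival (tau ^~ o) h <= n.+1)%N; split.
- apply: (prefix_measurable_set h.+1 (fun t => arrival t h <= n.+1)%N).
  by move=> t u tu; rewrite (eq_arrival t u).
- apply: le_trans (early_arrival_le _ _) _; rewrite add0r.
  have y0 : 0 < C * n.+1%:R `^ (eps / 2) by rewrite mulr_gt0// powR_gt0.
  apply: le_trans (_ : expR (- (C * n.+1%:R `^ (eps / 2))) <= _).
    rewrite ler_expR lerN2.
    have hx : x <= h.+1%:R by rewrite ltW// truncnS_gt.
    have := tail n.+1 (leqW n0n).
    have t0 : 0 <= C * n.+1%:R `^ (- (1 - eps)) by rewrite mulr_ge0 ?powR_ge0// ltW.
    move=> /(ler_pM x0 t0 hx); apply: le_trans.
    rewrite /x mulrCA -powRD ?pnatr_eq0 ?implybT// (_ : _ + _ = eps / 2)//.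
    by field.
  rewrite expRN; apply: le_trans (_ : (C * n.+1%:R `^ (eps / 2))^-1 <= _).
    rewrite lef_pV2 ?posrE ?expR_gt0//; apply: le_trans (expR_ge1Dx _).
    by rewrite lerDr.
  by rewrite invfM -powRN ler_wpM2r ?powR_ge0// le_max lexx.
- move=> o; rewrite -ltnNge => /(arrival_count_le J) ch.
  rewrite divr1 -/x.
  have cx : (arrival_count J (tau ^~ o) n.+1)%:R <= x.
    by apply: le_trans (_ : h%:R <= _); rewrite ?ler_nat// truncn_le.
  have -> : (s + n.+1 + arrival_count J (tau ^~ o) n.+1)%:R - n.+1%:R =
      (s + arrival_count J (tau ^~ o) n.+1)%:R :> R by rewrite !natrD; ring.
  rewrite ger0_norm// natrD.
  apply: le_trans (_ : s.+1%:R * x <= _).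
    have : s%:R <= s%:R * x by rewrite ler_peMr.
    by rewrite -natr1 mulrDl mul1r; lra.
  by rewrite ler_wpM2r// le_max lexx orbT.
Qed.

End Concentration.

(** * Concentration for light-tailed waiting times *)

Section TruncatedDeviations.
Context {R : realType} {d} {T : measurableType d} (P : probability T R)
  (tau : nat -> {RV P >-> nat}) (pi : probability nat R).
Hypothesis iid : iid_law P tau pi.

(** From exp (u/2) <= 1 / (1 - u/2), because
(1 + u + 2 u^2) (1 - u/2)^2 - 1 = u^2 (1 - u) (5 - 2 u) / 4. *)
Lemma expR_le_quad (u : R) : u <= 1 -> expR u <= 1 + u + 2 * u ^+ 2.
Proof.
move=> u1; have v0 : 0 < 1 - u / 2 by lra.
have e1 : expR (u / 2) * (1 - u / 2) <= 1.
  rewrite -[leRHS](expRxMexpNx_1 (u / 2)) ler_wpM2l ?expR_ge0//.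
  exact: expR_ge1Dx (- (u / 2)).
have -> : expR u = expR (u / 2) ^+ 2 by rewrite expr2 -expRD; congr expR; field.
have -> : expR (u / 2) ^+ 2 = (expR (u / 2) * (1 - u / 2)) ^+ 2 / (1 - u / 2) ^+ 2.
  by rewrite exprMn mulfK// expf_neq0// gt_eqF.
rewrite ler_pdivrMr ?exprn_gt0//.
apply: le_trans (_ : 1 <= _).
  by rewrite exprn_ile1// mulr_ge0 ?expR_ge0// ltW.
have -> : (1 + u + 2 * u ^+ 2) * (1 - u / 2) ^+ 2 =
   1 + u ^+ 2 * ((1 - u) * (5 - 2 * u) / 4) by field.
rewrite lerDl mulr_ge0 ?sqr_ge0// divr_ge0// mulr_ge0; lra.
Qed.

Let min_bounded (f : nat -> R) L :
  @bounded_measurable R _ nat (fun t => f (minn t L)).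
Proof.
apply: (nat_bounded_measurable _ (\sum_(i < L.+1) `|f i|)) => t.
have tL : (minn t L < L.+1)%N by rewrite ltnS geq_minr.
by rewrite (bigD1 (Ordinal tL))//= lerDl sumr_ge0.
Qed.

(** [expR_le_quad] applies because |theta| min(t, L) <= 1; the resulting quadratic
expression is at most its exponential. *)
Lemma Ex_expR_minn (theta M : R) (L : nat) : `|theta| * L%:R <= 1 ->
  Ex pi (fun t => (minn t L)%:R ^+ 2) <= M ->
  Ex pi (fun t => expR (theta * (minn t L)%:R)) <=
  expR (theta * Ex pi (fun t => (minn t L)%:R) + 2 * theta ^+ 2 * M).
Proof.
move=> thL EM; apply: le_trans (expR_ge1Dx _).
have b1 := min_bounded (fun v => v%:R) L.
have b2 := min_bounded (fun v => v%:R ^+ 2) L.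
have bc c : @bounded_measurable R _ nat (fun=> c) by exact: bounded_measurable_cst.
have bz c (f : nat -> R) : @bounded_measurable R _ nat f ->
    @bounded_measurable R _ nat (fun t => c * f t).
  by move=> bf; apply: bounded_measurableM.
apply: le_trans (_ : Ex pi (fun t => 1 + theta * (minn t L)%:R
   + 2 * theta ^+ 2 * (minn t L)%:R ^+ 2) <= _).
  apply: le_Ex.
  - exact: (min_bounded (fun v => expR (theta * v%:R)) L).
  - by apply: bounded_measurableD; [apply: bounded_measurableD => //|]; apply: bz.
  move=> t; apply: le_trans (expR_le_quad _ _) _; last by rewrite exprMn mulrA.
  apply: le_trans thL; apply: le_trans (ler_norm _) _.
  by rewrite normrM ler_wpM2l// ger0_norm// ler_nat geq_minr.
rewrite ExD; [|by apply: bounded_measurableD => //; apply: bz|exact: bz].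
rewrite ExD ?Ex_cst ?ExZ//; last exact: bz.
rewrite -addrA lerD2l lerD2l ler_wpM2l// mulr_ge0// sqr_ge0//.
Qed.

Section Deviations.
Variables (mu M p : R).
Hypotheses (mu0 : 0 < mu) (M0 : 0 <= M).
Hypotheses (mean_le : forall L, Ex pi (fun t => (minn t L)%:R) <= mu)
  (mean_ge : forall L, (0 < L)%N -> mu - M / L%:R <= Ex pi (fun t => (minn t L)%:R))
  (square_le : forall L, Ex pi (fun t => (minn t L)%:R ^+ 2) <= M)
  (tail_le : forall L, (0 < L)%N -> Ex pi (fun t => (L < t)%N%:R) <= M / L%:R `^ p).

(** Chernoff's bound at parameter -1/L.  Truncation lowers the mean by at most
M / L, which costs as much as the quadratic term. *)
Lemma early_arrival_deviation (n h L : nat) : (0 < L)%N ->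
  Ex P (fun o => (arrival (tau ^~ o) h <= n)%N%:R) <=
  expR (L%:R^-1 * (n%:R - h.+1%:R * mu) + 3 * h.+1%:R * L%:R ^- 2 * M).
Proof.
move=> L0; have L0' : (0 : R) < L%:R by rewrite ltr0n.
set lam : R := L%:R^-1.
have lam0 : 0 < lam by rewrite invr_gt0.
have bterm : bounded_measurable (fun o =>
    (- lam * n%:R <= \sum_(i < h.+1) - lam * (minn (tau i o) L)%:R)%R%:R : R).
  apply: (prefix_bounded_measurable_bool P tau h.+1
    (fun t => - lam * n%:R <= \sum_(i < h.+1) - lam * (minn (t i) L)%:R)) => t u tu.
  by congr (_ <= _); apply: eq_bigr => i _; rewrite tu.
apply: le_trans (_ : Ex P (fun o =>
    (- lam * n%:R <= \sum_(i < h.+1) - lam * (minn (tau i o) L)%:R)%R%:R) <= _).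
  apply: le_Ex => //; first exact: (arrival_measurable P tau n h).2.
  move=> o; rewrite ler_nat; case: (leqP (arrival (tau ^~ o) h) n) => // tn.
  rewrite lt0b -mulr_sumr ler_nM2l ?oppr_lt0// -natr_sum ler_nat.
  by apply: leq_trans tn; apply: leq_sum => i _; exact: geq_minl.
apply: le_trans (chernoff P tau pi iid _ _ _ _) _.
have thL : `|- lam| * L%:R <= 1 by rewrite normrN gtr0_norm// mulVf// gt_eqF.
have A := Ex_expR_minn (- lam) M L thL (square_le L).
apply: le_trans (_ : expR (- (- lam * n%:R)) *
  expR (- lam * Ex pi (fun t => (minn t L)%:R) + 2 * (- lam) ^+ 2 * M) ^+ h.+1 <= _).
  rewrite ler_wpM2l ?expR_ge0// lerXn2r ?nnegrE ?expR_ge0//.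
  by apply: Ex_ge0 => t; exact: expR_ge0.
rewrite -expRM_natl -expRD ler_expR.
have -> : L%:R ^- 2 = lam ^+ 2 by rewrite exprVn.
have B : lam * (mu - M * lam) <= lam * Ex pi (fun t => (minn t L)%:R).
  by rewrite ler_wpM2l ?mean_ge// ltW.
have : h.+1%:R * (lam * (mu - M * lam)) <= h.+1%:R * (lam * Ex pi (fun t => (minn t L)%:R)).
  by rewrite ler_wpM2l.
by set H := h.+1%:R; set m := Ex _ _; rewrite sqrrN; lra.
Qed.

(** Either the truncated sum is large, which Chernoff's bound at parameter 1/L
controls, or one of the j waiting times exceeds L. *)
Lemma late_arrival_deviation (n j L : nat) : (0 < L)%N ->
  Ex P (fun o => (n < \sum_(i < j) tau i o)%N%:R) <=
  expR (- (L%:R^-1 * (n%:R - j%:R * mu)) + 3 * j%:R * L%:R ^- 2 * M)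
  + j%:R * (M / L%:R `^ p).
Proof.
move=> L0; have L0' : (0 : R) < L%:R by rewrite ltr0n.
set lam : R := L%:R^-1.
have lam0 : 0 < lam by rewrite invr_gt0.
have bterm : bounded_measurable (fun o =>
    (lam * n%:R <= \sum_(i < j) lam * (minn (tau i o) L)%:R)%R%:R : R).
  apply: (prefix_bounded_measurable_bool P tau j
    (fun t => lam * n%:R <= \sum_(i < j) lam * (minn (t i) L)%:R)) => t u tu.
  by congr (_ <= _); apply: eq_bigr => i _; rewrite tu.
have bbig i : bounded_measurable (fun o => (L < tau i o)%N%:R : R).
  apply: (prefix_bounded_measurable_bool P tau i.+1 (fun t => L < t i)%N).
  by move=> t u tu; rewrite tu.
apply: le_trans (_ : Ex P (fun o =>
    (lam * n%:R <= \sum_(i < j) lam * (minn (tau i o) L)%:R)%R%:R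
    + \sum_(i < j) (L < tau i o)%N%:R) <= _).
  apply: le_Ex.
  - apply: (prefix_bounded_measurable_bool P tau j (fun t => n < \sum_(i < j) t i)%N).
    by move=> t u tu; under eq_bigr => i _ do rewrite tu//.
  - by apply: bounded_measurableD => //; exact: bounded_measurable_sum.
  move=> o; case: (ltnP n (\sum_(i < j) tau i o)%N) => [nt|_] /=; last first.
    by rewrite addr_ge0// sumr_ge0.
  have [[i Li]|small] := pselect (exists i : 'I_j, (L < tau i o)%N).
    rewrite [X in _ <= _ + X](bigD1 i)//= Li addrCA lerDl addr_ge0// sumr_ge0//.
  rewrite -mulr_sumr ler_pM2l// -natr_sum ler_nat (_ : (n <= _)%N = true)//.
    by rewrite lerDl sumr_ge0.
  apply: leq_trans (ltnW nt) _; apply: leq_sum => i _.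
  rewrite leq_min leqnn/= leqNgt; apply/negP => Li.
  by apply: small; exists i.
rewrite ExD//; last exact: bounded_measurable_sum.
apply: lerD; last first.
  rewrite Ex_sum// -[j in leRHS]card_ord mulrC mulr_natr -sumr_const.
  apply: ler_sum => i _; apply: le_trans (tail_le L L0).
  rewrite !Ex_indic//; last exact: (prefix_measurable_set P tau i.+1 (fun t => L < t i)%N (fun t u tu => congr1 _ (tu _ (ltnSn i)))).
  by rewrite -(iid.1 i).
apply: le_trans (chernoff P tau pi iid _ _ _ _) _.
have thL : `|lam| * L%:R <= 1 by rewrite gtr0_norm// mulVf// gt_eqF.
have A := Ex_expR_minn lam M L thL (square_le L).
apply: le_trans (_ : expR (- (lam * n%:R)) *
  expR (lam * Ex pi (fun t => (minn t L)%:R) + 2 * lam ^+ 2 * M) ^+ j <= _).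
  rewrite ler_wpM2l ?expR_ge0// lerXn2r ?nnegrE ?expR_ge0//.
  by apply: Ex_ge0 => t; exact: expR_ge0.
rewrite -expRM_natl -expRD ler_expR.
have -> : L%:R ^- 2 = lam ^+ 2 by rewrite exprVn.
have : j%:R * (lam * Ex pi (fun t => (minn t L)%:R)) <= j%:R * (lam * mu).
  by rewrite ler_wpM2l// ler_wpM2l// ltW.
have : 0 <= j%:R * lam ^+ 2 * M by rewrite mulr_ge0// mulr_ge0// sqr_ge0.
by set H := j%:R; set m := Ex _ _; lra.
Qed.

End Deviations.
End TruncatedDeviations.

Section LightTailConcentration.
Context {R : realType} {d} {T : measurableType d} (P : probability T R)
  (tau : nat -> {RV P >-> nat}) (pi : probability nat R) (s : nat).
Hypothesis iid : iid_law P tau pi.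

(** The m-th power of exp (x / m) >= x / m. *)
Lemma expRN_le_pow (x : R) (m : nat) : 0 < x -> (0 < m)%N ->
  expR (- x) <= (m%:R / x) ^+ m.
Proof.
move=> x0 m0; have m0' : (0 : R) < m%:R by rewrite ltr0n.
have -> : (m%:R / x) ^+ m = ((x / m%:R) ^+ m)^-1 by rewrite -exprVn invf_div.
rewrite expRN lef_pV2 ?posrE ?expR_gt0 ?exprn_gt0 ?divr_gt0//.
have -> : expR x = expR (x / m%:R) ^+ m.
  by rewrite -expRM_natl mulrC divfK// gt_eqF.
rewrite lerXn2r ?nnegrE ?expR_ge0 ?divr_ge0 ?ltW//.
by apply: lt_le_trans (expR_ge1Dx _); rewrite ltrDr.
Qed.

Variables (mu M p : R).
Hypotheses (mu0 : 0 < mu) (M0 : 0 <= M) (p0 : 0 < p).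
Hypotheses (mean_le : forall L, Ex pi (fun t => (minn t L)%:R) <= mu)
  (mean_ge : forall L, (0 < L)%N -> mu - M / L%:R <= Ex pi (fun t => (minn t L)%:R))
  (square_le : forall L, Ex pi (fun t => (minn t L)%:R ^+ 2) <= M)
  (tail_le : forall L, (0 < L)%N -> Ex pi (fun t => (L < t)%N%:R) <= M / L%:R `^ p).

(** The deviation n^(3/4) is larger than the standard deviation, of order sqrt n,
by the factor n^(1/4), and this factor appears in the exponent of Chernoff's
bound with 1/L of order n^(-1/2). *)
Lemma concentrated_light_tail (kappa delta : R) :
  0 <= kappa -> 0 < delta -> delta <= 4^-1 -> kappa + delta <= p / 2 - 1 ->
  exists2 C, 0 <= C & concentrated P tau s (mu / (mu + 1)) kappa delta C.
Proof.
move=> k0 d0 d4 kd.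
have mu1 : 0 < mu + 1 by rewrite addr_gt0.
have kd0 : 0 < kappa + delta by rewrite ltr_wpDl.
(* exp (- x) <= (m / x)^m with x = mu n^(1/4) gives the rate n^(-m/4). *)
pose m := (Num.truncn (4 * (kappa + delta))).+1.
have m0 : (0 : R) < m%:R by rewrite ltr0n.
have m4 : kappa + delta <= m%:R / 4.
  by rewrite ler_pdivlMr// mulrC ltW// truncnS_gt.
pose A0 := 12 * (mu^-1 + 2) * M.
pose C1 := 2 * (expR A0 * (m%:R / mu) ^+ m) + mu^-1 * M * 2 `^ p.
pose C := Num.max C1 (s.+2%:R).
apply: (@concentrated_eventually _ _ _ P tau s _ _ _ C (Num.truncn (mu ^+ 4))) => //.
- by rewrite divr_gt0.
- by rewrite ler_pdivrMr// mul1r lerDl.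
move=> n n0.
set N : R := n.+1%:R.
have N0 : 0 < N by [].
have N1 : 1 <= N by rewrite ler1n.
have Nn0 : N != 0 by rewrite gt_eqF.
have ND a b : N `^ (a + b) = N `^ a * N `^ b by rewrite powRD// Nn0 implybT.
have N00 a : 0 < N `^ a by rewrite powR_gt0.
have Nle a b : a <= b -> N `^ a <= N `^ b by move=> ab; rewrite ler_powR.
pose x := N `^ (3 / 4).
pose q := N `^ 2^-1.
have x0 : 0 < x by exact: N00.
have q0 : 0 < q by exact: N00.
have x1 : 1 <= x by rewrite /x -[leLHS](powRr0 N) Nle//; lra.
have q1 : 1 <= q by rewrite /q -[leLHS](powRr0 N) Nle//; lra.
have xN : x <= N by rewrite /x -[leRHS]powRr1 ?(ltW N0)// Nle//; lra.
have qq : q * q = N by rewrite /q -ND -[RHS]powRr1 ?(ltW N0)//; congr powR; field.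
have xq : x = q * N `^ 4^-1 by rewrite /x /q -ND; congr powR; field.
have Nx : N = x * N `^ 4^-1 by rewrite /x -ND -[LHS]powRr1 ?(ltW N0)//; congr powR; field.
(* Here n is large enough for N / mu - x to be nonnegative. *)
have muN : mu <= N `^ 4^-1.
  have : mu ^+ 4 <= N by rewrite ltW// (lt_le_trans (truncnS_gt _))// ler_nat.
  move=> muN4; have : (mu ^+ 4) `^ 4^-1 <= N `^ 4^-1.
    by apply: ge0_ler_powR; rewrite ?nnegrE ?invr_ge0 ?exprn_ge0// ltW.
  by rewrite -powR_mulrn ?(ltW mu0)// -powRrM mulfV// powRr1// ltW.
pose L := Num.truncn q.
have L0 : (0 < L)%N by rewrite truncn_gt0.
have L0' : (0 : R) < L%:R by rewrite ltr0n.
have Lq : L%:R <= q by rewrite truncn_le ltW.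
have qL : q <= 2 * L%:R.
  have qL1 : q <= L.+1%:R by exact: ltW (truncnS_gt q).
  by apply: le_trans qL1 _; rewrite -natrM ler_nat mul2n -addnn -addn1 leq_add2l.
have lamq : q^-1 <= L%:R^-1 by rewrite lef_pV2.
have lam2 : L%:R ^- 2 <= 4 / N.
  rewrite -[4 / N]invrK lef_pV2 ?posrE ?exprn_gt0 ?invr_gt0 ?divr_gt0//.
  rewrite invf_div ler_pdivrMr// -qq.
  apply: le_trans (_ : (2 * L%:R) * (2 * L%:R) <= _); last by rewrite expr2; lra.
  by rewrite ler_pM// ltW.
(* With L between sqrt n / 2 and sqrt n, the term D / L is at least n^(1/4) mu
   and the quadratic term is bounded; exp (- n^(1/4) mu) beats any power. *)
have chern (D : R) (j : R) : mu * x <= D -> 0 <= j -> j <= N * (mu^-1 + 2) ->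
    expR (- (L%:R^-1 * D) + 3 * j * L%:R ^- 2 * M) <=
    expR A0 * (m%:R / mu) ^+ m * N `^ (- (kappa + delta)).
  move=> xD j0 jN.
  have e1 : 3 * j * L%:R ^- 2 * M <= A0.
    have : j * L%:R ^- 2 <= N * (mu^-1 + 2) * (4 / N).
      by apply: ler_pM => //; rewrite invr_ge0 exprn_ge0.
    have -> : N * (mu^-1 + 2) * (4 / N) = 4 * (mu^-1 + 2).
      by field; rewrite !gt_eqF.
    move=> /(ler_wpM2r M0); rewrite /A0.
    by set Z := L%:R ^- 2; set Y := mu^-1; lra.
  have e2 : mu * N `^ 4^-1 <= L%:R^-1 * D.
    apply: le_trans (_ : q^-1 * (mu * x) <= _).
      by rewrite xq mulrCA [q^-1 * _]mulKf// gt_eqF.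
    by apply: ler_pM => //; rewrite ?invr_ge0 ?mulr_ge0// ltW.
  rewrite [X in expR X]addrC expRD -[leRHS]mulrA; apply: ler_pM; rewrite ?expR_ge0 ?ler_expR//.
  apply: le_trans (_ : expR (- (mu * N `^ 4^-1)) <= _).
    by rewrite ler_expR lerN2.
  apply: le_trans (expRN_le_pow _ m _ _) _ => //; first by rewrite mulr_gt0.
  rewrite invfM mulrA exprMn; apply: ler_wpM2l.
    by rewrite exprn_ge0// divr_ge0// ltW.
  rewrite exprVn -powR_mulrn ?powR_ge0// -powRrM -powRN Nle// lerN2.
  by rewrite mulrC.
(* If h + 1 waiting times add up to more than n and j of them do not, then
   the number of additions lies between j and h. *)
pose h := Num.truncn (N / mu + x).
pose j := Num.truncn (N / mu - x).
have Nmu0 : 0 <= N / mu by rewrite divr_ge0// ltW.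
have hx0 : 0 <= N / mu + x by rewrite addr_ge0// ltW.
have hx : N / mu + x <= h.+1%:R by rewrite ltW// truncnS_gt.
have hx' : h%:R <= N / mu + x by rewrite truncn_le.
have jx0 : 0 <= N / mu - x.
  by rewrite subr_ge0 ler_pdivlMr// [leRHS]Nx ler_wpM2l// ltW.
have jx : j%:R <= N / mu - x by rewrite truncn_le.
have jx' : N / mu - x <= j%:R + 1 by rewrite natr1 ltW// truncnS_gt.
have jh : (j <= h)%N by apply: le_truncn; lra.
exists h.+1 => J hJ.
pose B1 o := (arrival (tau ^~ o) h <= n.+1)%N.
pose B2 o := (n.+1 < \sum_(i < j) tau i o)%N.
have mB1 : measurable [set o | B1 o].
  apply: (prefix_measurable_set P tau h.+1 (fun t => arrival t h <= n.+1)%N).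
  by move=> t u tu; rewrite (eq_arrival t u).
have mB2 : measurable [set o | B2 o].
  apply: (prefix_measurable_set P tau j (fun t => n.+1 < \sum_(i < j) t i)%N).
  by move=> t u tu; under eq_bigr => i _ do rewrite tu//.
have mB : measurable [set o | B1 o || B2 o].
  rewrite (_ : [set o | B1 o || B2 o] = [set o | B1 o] `|` [set o | B2 o]).
    exact: measurableU.
  by apply/seteqP; split=> o /=; [move/orP|move=> ?; exact/orP].
exists (fun o => B1 o || B2 o); split => //.
- apply: le_trans (_ : Ex P (fun o => (B1 o)%:R) + Ex P (fun o => (B2 o)%:R) <= _).
    rewrite -ExD; try exact: bounded_measurable_indic.
    apply: le_Ex; first exact: bounded_measurable_indic.
      by apply: bounded_measurableD; exact: bounded_measurable_indic.
    by move=> o; case: (B1 o); case: (B2 o); rewrite /= ?addr0 ?add0r// lerDl.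
  apply: le_trans (_ : C1 * N `^ (- (kappa + delta)) <= _); last first.
    by rewrite ler_wpM2r ?powR_ge0// le_max lexx.
  have b1 : Ex P (fun o => (B1 o)%:R) <=
      expR A0 * (m%:R / mu) ^+ m * N `^ (- (kappa + delta)).
    apply: le_trans (early_arrival_deviation P tau pi iid mu M mean_ge square_le n.+1 h L L0) _.
    rewrite -/N -[N - _]opprB mulrN; apply: chern => //.
      rewrite -(ler_pM2r mu0) in hx; move: hx.
      by rewrite mulrDl divfK ?gt_eqF//; lra.
    rewrite -natr1 mulrDr; apply: le_trans (lerD hx' (lexx 1)) _; lra.
  have b2 : Ex P (fun o => (B2 o)%:R) <=
      expR A0 * (m%:R / mu) ^+ m * N `^ (- (kappa + delta))
      + mu^-1 * M * 2 `^ p * N `^ (- (kappa + delta)).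
    apply: le_trans (late_arrival_deviation P tau pi iid mu M p M0 mean_le square_le tail_le n.+1 j L L0) _.
    apply: lerD.
      apply: chern => //.
        rewrite -(ler_pM2r mu0) in jx; move: jx.
        by rewrite mulrBl divfK ?gt_eqF// -/N; lra.
      rewrite mulrDr; apply: le_trans jx _; lra.
    have Lp : (L%:R `^ p)^-1 <= 2 `^ p * N `^ (- (p / 2)).
      have qp : N `^ (p / 2) = q `^ p by rewrite /q -powRrM mulrC.
      rewrite powRN qp ler_pdivlMr ?powR_gt0// mulrC ler_pdivrMr ?powR_gt0//.
      rewrite -powRM ?(ltW L0')//; apply: ge0_ler_powR => //; first exact: ltW.
        by rewrite nnegrE ltW.
      by rewrite nnegrE mulr_ge0// ltW.
    have jN : j%:R <= N / mu by apply: le_trans jx _; lra.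
    apply: le_trans (_ : N / mu * (M * (2 `^ p * N `^ (- (p / 2)))) <= _).
      apply: ler_pM => //; first by rewrite divr_ge0// powR_ge0.
      by rewrite ler_wpM2l.
    rewrite [leLHS](_ : _ = mu^-1 * M * 2 `^ p * (N * N `^ (- (p / 2)))); last by ring.
    apply: ler_wpM2l.
      by rewrite mulr_ge0 ?powR_ge0// mulr_ge0// invr_ge0 ltW.
    rewrite -[X in X * _]powRr1 ?(ltW N0)// -ND Nle//; lra.
  by apply: le_trans (lerD b1 b2) _; rewrite /C1; lra.
- move=> o; rewrite negb_or => /andP[nB1 nB2].
  rewrite -ltnNge in nB1; rewrite -leqNgt in nB2.
  have ch := arrival_count_le J _ _ _ nB1.
  have jc : (j <= arrival_count J (tau ^~ o) n.+1)%N.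
    case: (posnP j) => [->//|j0].
    move: nB2; rewrite -(prednK j0) => nB2.
    by apply: arrival_count_ge => //; rewrite prednK// ltnW// (leq_ltn_trans jh).
  set c := arrival_count _ _ _.
  have c1 : c%:R <= N / mu + x by apply: le_trans hx'; rewrite ler_nat.
  have c2 : N / mu - x - 1 <= c%:R.
    by rewrite lerBlDr; apply: le_trans jx' _; rewrite lerD2r ler_nat.
  have -> : (s + n.+1 + c)%:R - N / (mu / (mu + 1)) = s%:R + (c%:R - N / mu).
    by rewrite !natrD -/N; field; rewrite !gt_eqF.
  apply: le_trans (_ : s.+2%:R * x <= _).
    apply: le_trans (ler_normD _ _) _; rewrite ger0_norm//.
    have : `|c%:R - N / mu| <= x + 1 by rewrite ler_norml; apply/andP; split; lra.
    have : s%:R <= s%:R * x by rewrite ler_peMr.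
    by rewrite -[s.+2%:R]natr1 -[s.+1%:R]natr1; lra.
  apply: ler_pM => //; first exact: ltW.
    by rewrite le_max lexx orbT.
  by apply: Nle; lra.
Qed.

End LightTailConcentration.

(** * Moments and tails of the waiting time *)

Section WaitingTime.
Context {R : realType} (pi : probability nat R).

Let nat_measurable (f : nat -> R) : measurable_fun setT (EFin \o f).
Proof. by move=> _ Y mY; rewrite setTI. Qed.

Let nat_integrable (f : nat -> R) : (forall t, 0 <= f t) ->
  (\int[pi]_t (f t)%:E < +oo)%E -> pi.-integrable setT (EFin \o f).
Proof.
move=> f0 fi; apply/integrableP; split; first exact: nat_measurable.
by under eq_integral => t _ do rewrite /= ger0_norm//.
Qed.

Let le_integral_pi (f g : nat -> R) : (forall t, 0 <= f t) -> (forall t, f t <= g t) ->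
  (\int[pi]_t (f t)%:E <= \int[pi]_t (g t)%:E)%E.
Proof.
move=> f0 fg; apply: ge0_le_integral => //; try exact: nat_measurable.
  by move=> t _; rewrite lee_fin.
by move=> t _; rewrite lee_fin.
Qed.

Let le_pi (f g : nat -> R) : (forall t, 0 <= f t) -> (forall t, f t <= g t) ->
  (\int[pi]_t (g t)%:E < +oo)%E -> Ex pi f <= Ex pi g.
Proof.
move=> f0 fg gi.
have ig : pi.-integrable setT (EFin \o g).
  by apply: nat_integrable => // t; exact: le_trans (fg t).
apply: le_Rintegral => //; apply: nat_integrable => //.
by apply: le_lt_trans gi; exact: le_integral_pi.
Qed.

(** Integer values give tau <= tau^2 <= tau^p, so the moment of order p bounds the
second moment, and tau - min(tau, L) <= tau^2 / L. *)
Lemma waiting_time_moments (p : R) : 2 <= p ->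
  (\int[pi]_t (t%:R `^ p)%:E < +oo)%E ->
  let mu := fine (mean pi) in let M := Ex pi (fun t => t%:R `^ p) in
  [/\ mean pi = mu%:E,
      forall L, Ex pi (fun t => (minn t L)%:R) <= mu,
      forall L, (0 < L)%N -> mu - M / L%:R <= Ex pi (fun t => (minn t L)%:R),
      forall L, Ex pi (fun t => (minn t L)%:R ^+ 2) <= M &
      forall L, (0 < L)%N -> Ex pi (fun t => (L < t)%N%:R) <= M / L%:R `^ p].
Proof.
move=> p2 pfin mu M.
have pow0 (t : nat) : 0 <= t%:R `^ p :> R by exact: powR_ge0.
have sqr_pow (t : nat) : t%:R ^+ 2 <= t%:R `^ p :> R.
  case: t => [|t]; first by rewrite expr0n/= powR_ge0.
  by rewrite -powR_mulrn// ler_powR// ler1n.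
have id_sqr (t : nat) : t%:R <= t%:R ^+ 2 :> R.
  by rewrite -natrX ler_nat; case: t => // t; rewrite -mulnn leq_pmulr.
have tfin : (mean pi < +oo)%E.
  apply: le_lt_trans pfin; apply: le_integral_pi => // t.
  exact: le_trans (id_sqr t) (sqr_pow t).
have mean0 : (0 <= mean pi)%E by apply: integral_ge0 => t _; rewrite lee_fin.
have muE : mean pi = mu%:E by rewrite fineK// ge0_fin_numE.
have muEx : mu = Ex pi (fun t => t%:R) by [].
have it : pi.-integrable setT (EFin \o (fun t => t%:R : R)) by exact: nat_integrable.
have ip : pi.-integrable setT (EFin \o (fun t => t%:R `^ p : R)) by exact: nat_integrable.
split => //.
- by move=> L; rewrite muEx; apply: le_pi => // t; rewrite ler_nat geq_minl.
- move=> L L0; have L0' : (0 : R) < L%:R by rewrite ltr0n.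
  rewrite lerBlDr muEx /Ex -RintegralZr//.
  have iM : pi.-integrable setT (EFin \o (fun t : nat => t%:R `^ p / L%:R : R)).
    apply: (eq_integrable _ (fun t => (t%:R `^ p)%:E * (L%:R^-1)%:E)%E) => //.
    exact: integrableZr.
  have imin : pi.-integrable setT (EFin \o (fun t : nat => (minn t L)%:R : R)).
    apply: nat_integrable => //; apply: le_lt_trans tfin.
    by apply: le_integral_pi => // t; rewrite ler_nat geq_minl.
  rewrite -RintegralD//; apply: le_Rintegral => //.
    pose f1 (t : nat) : R := (minn t L)%:R.
    pose f2 (t : nat) : R := t%:R `^ p / L%:R.
    apply: (@eq_integrable _ _ _ pi setT measurableT ((EFin \o f1) \+ (EFin \o f2))%E) => //.
    exact: integrableD.
  move=> t _; have [tL|Lt] := leqP t L.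
    by rewrite lerDl divr_ge0.
  apply: le_trans (_ : t%:R ^+ 2 / L%:R <= _).
    by rewrite ler_pdivlMr// expr2 ler_wpM2l// ler_nat ltnW.
  apply: le_trans (_ : t%:R `^ p / L%:R <= _); last by rewrite lerDr.
  by rewrite ler_wpM2r// invr_ge0.
- move=> L; apply: le_pi => // t.
  by apply: le_trans (sqr_pow t); rewrite lerXn2r ?nnegrE// ler_nat geq_minl.
- move=> L L0; have L0' : (0 : R) < L%:R by rewrite ltr0n.
  rewrite ler_pdivlMr ?powR_gt0// mulrC -ExZ; last exact: nat_bounded_measurable_bool.
  apply: le_pi => // t.
  case: ltnP => Lt; last by rewrite mulr0.
  rewrite mulr1; apply: ge0_ler_powR; rewrite ?nnegrE//; first by lra.
  by rewrite ler_nat ltnW.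
Qed.

(** Markov's inequality: n P(tau > n) >= C n^eps would stay below a finite mean. *)
Lemma heavy_tail_mean (eps C : R) (n0 : nat) : 0 < eps -> 0 < C ->
  (forall n, (n0 <= n)%N ->
     C * n%:R `^ (- (1 - eps)) <= Ex pi (fun t => (n < t)%N%:R)) ->
  mean pi = +oo%E.
Proof.
move=> e0 C0 tail.
have mean0 : (0 <= mean pi)%E by apply: integral_ge0 => t _; rewrite lee_fin.
apply/eqP; rewrite eq_le leey/= leNgt; apply/negP => tfin.
set mu := fine (mean pi).
have markov n : n%:R * Ex pi (fun t => (n < t)%N%:R) <= mu.
  rewrite -ExZ; last exact: nat_bounded_measurable_bool.
  apply: le_pi => // t.
  by case: ltnP => nt; rewrite ?mulr0// mulr1 ler_nat ltnW.
have mu0 : 0 <= mu by exact: fine_ge0.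
pose n := maxn n0 (Num.truncn ((mu / C) `^ eps^-1)).+1.
have n1 : (0 < n)%N by rewrite leq_max orbT.
have n1' : (0 : R) < n%:R by rewrite ltr0n.
have := markov n; apply/negP; rewrite -ltNge.
apply: (@lt_le_trans _ _ (n%:R * (C * n%:R `^ (- (1 - eps))))); last first.
  by rewrite ler_wpM2l// tail// leq_maxl.
have -> : n%:R * (C * n%:R `^ (- (1 - eps))) = C * n%:R `^ eps.
  rewrite mulrCA -[X in _ * (X * _)]powRr1 ?(ltW n1')// -powRD ?(gt_eqF n1') ?implybT//.
  by congr (_ * powR _ _); ring.
rewrite -ltr_pdivrMl// mulrC.
have base0 : 0 <= mu / C by rewrite divr_ge0// ltW.
have -> : mu / C = ((mu / C) `^ eps^-1) `^ eps.
  by rewrite -powRrM mulVf ?gt_eqF// powRr1.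
apply: gt0_ltr_powR => //; rewrite ?nnegrE ?powR_ge0 ?(ltW n1')//.
by apply: lt_le_trans (truncnS_gt _) _; rewrite ler_nat leq_maxr.
Qed.

(** Under (a) the exponent (k + 1) / (mu + 1) of the moment condition is
kappa + 1 / (mu + 1), which leaves room for delta = min(1/4, 1 / (mu + 1)). *)
Lemma waiting_time_concentrated (k : nat) :
  (0 < mean pi)%E ->
  (exists p : R,
     [/\ 1 < p,
         (\int[pi]_t (t%:R `^ p)%:E < +oo)%E &
         (k%:R%:E < (p / 2 - 1)%:E * (mean pi + 1) - 1)%E]) \/
  (exists eps C : R,
     [/\ 0 < eps, 0 < C &
         \forall n \near \oo,
           ((C * n%:R `^ (- (1 - eps)))%:E <= pi [set t | (n < t)%N])%E]) ->
  let alpha := growth_exponent (mean pi) in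
  [/\ 0 < alpha, alpha <= 1 &
  exists2 delta, 0 < delta <= 1 &
  forall s d (T : measurableType d) (P : probability T R) (tau : nat -> {RV P >-> nat}),
    (0 < s)%N -> iid_law P tau pi ->
    exists2 C, 0 <= C & concentrated P tau s alpha (k%:R * (1 - alpha)) delta C].
Proof.
move=> mu_gt0; case=> [[p [p1 pfin kp]]|[eps [C [e0 C0 [n0 _ tail]]]]] alpha.
- have mean0 : (0 <= mean pi)%E by exact: ltW.
  have tfin : (mean pi < +oo)%E.
    apply: le_lt_trans pfin; apply: le_integral_pi => // -[|t]; first exact: powR_ge0.
    by rewrite le1r_powR ?ler1n// ltW.
  have muE : mean pi = (fine (mean pi))%:E by rewrite fineK// ge0_fin_numE.
  set mu := fine (mean pi) in muE.
  have mu0 : 0 < mu by rewrite -lte_fin -muE.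
  have mu1 : 0 < mu + 1 by rewrite addr_gt0.
  have kp' : k%:R < (p / 2 - 1) * (mu + 1) - 1.
    by rewrite -lte_fin; move: kp; rewrite muE.
  have p2 : 2 <= p.
    rewrite leNgt; apply/negP => p2.
    have : (p / 2 - 1) * (mu + 1) <= 0 by rewrite nmulr_rle0 ?(ltW mu1)//; lra.
    have : 0 <= k%:R :> R by [].
    lra.
  have [_ mle mge sq tl] := waiting_time_moments p p2 pfin.
  have alphaE : alpha = mu / (mu + 1) by rewrite /alpha muE.
  have kap : k%:R * (1 - alpha) = k%:R / (mu + 1).
    by rewrite alphaE; field; rewrite gt_eqF.
  split.
  + by rewrite alphaE divr_gt0.
  + by rewrite alphaE ler_pdivrMr// mul1r lerDl.
  pose delta : R := Num.min 4^-1 (mu + 1)^-1.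
  have d0 : 0 < delta by rewrite lt_min !invr_gt0 mu1 andbT.
  exists delta; first by rewrite d0 ge_min; apply/orP; left; lra.
  move=> s d T P tau s0 iid; rewrite alphaE -alphaE kap.
  rewrite alphaE; apply: (@concentrated_light_tail _ _ _ P tau pi s iid mu
    (Ex pi (fun t => t%:R `^ p)) p) => //.
  + by apply: Ex_ge0 => t; exact: powR_ge0.
  + by apply: lt_le_trans p2.
  + by rewrite divr_ge0// ltW.
  + by rewrite ge_min lexx.
  + apply: le_trans (_ : (k%:R + 1) / (mu + 1) <= _).
      by rewrite mulrDl mul1r lerD2l ge_min lexx orbT.
    by rewrite ler_pdivrMr//; lra.
- have tail' n : (n0 <= n)%N ->
      C * n%:R `^ (- (1 - eps)) <= Ex pi (fun t => (n < t)%N%:R).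
    move=> n0n; rewrite Ex_indic//.
    by have := tail n n0n; rewrite /= -[X in (_ <= X)%E]fineK ?lee_fin ?fin_num_measure.
  have -> : alpha = 1 by rewrite /alpha (heavy_tail_mean eps C n0).
  split => //.
  (* For eps > 1 the hypothesis is stronger than for eps = 1. *)
pose eps' : R := Num.min eps 1.
  have e'0 : 0 < eps' by rewrite lt_min e0 ltr01.
  have e'1 : eps' <= 1 by rewrite ge_min lexx orbT.
  exists (eps' / 2); first by apply/andP; split; lra.
  move=> s d T P tau s0 iid; rewrite subrr mulr0.
  apply: (@concentrated_heavy_tail _ _ _ P tau pi s iid eps' C (maxn n0 1)) => //.
  move=> n; rewrite geq_max => /andP[n0n n1]; apply: le_trans (tail' n n0n).
  rewrite ler_wpM2l ?(ltW C0)// ler_powR ?ler1n//.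
  by rewrite lerN2 lerD2l lerN2 ge_min lexx.
Qed.

End WaitingTime.

(** * From rising factorials to powers *)

Lemma expn_le_rising (k x : nat) : (x ^ k <= rising k x)%N.
Proof.
rewrite /rising -[k in (x ^ k)%N]card_ord -prod_nat_const.
by apply: leq_prod => i _; rewrite leq_addr.
Qed.

Lemma rising_le_expn (k : nat) : exists C : nat, forall x, (0 < x)%N ->
  (rising k.+1 x <= x ^ k.+1 + C * x ^ k)%N.
Proof.
elim: k => [|k [C IH]].
  by exists 0%N => x _; rewrite /rising big_ord_recl big_ord0 muln1 !addn0.
exists (C + k.+1 + C * k.+1)%N => x x0.
rewrite /rising big_ord_recr/= -/(rising k.+1 x).
apply: leq_trans (leq_mul (IH x x0) (leqnn _)) _.
have xk : (x ^ k <= x ^ k.+1)%N by rewrite expnS leq_pmull.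
have -> : ((x ^ k.+1 + C * x ^ k) * (x + k.+1) =
  x ^ k.+2 + (C + k.+1) * x ^ k.+1 + C * k.+1 * x ^ k)%N.
  by rewrite !expnS; ring.
by rewrite [in leqRHS]mulnDl addnA leq_add2l leq_mul2l xk orbT.
Qed.

Lemma natr_powR_cvg_pinfty {R : realType} (a : R) : 0 < a ->
  n%:R `^ (- a) @[n --> \oo] --> (0 : R).
Proof.
move=> a0; apply/cvgrPdist_le => e e0.
exists (Num.truncn (e^-1 `^ a^-1)).+1 => //= n tn.
have n0 : (0 : R) < n%:R by rewrite ltr0n; exact: leq_trans tn.
rewrite sub0r normrN ger0_norm ?powR_ge0// powRN -[leRHS]invrK.
rewrite lef_pV2 ?posrE ?invr_gt0 ?powR_gt0//.
have -> : e^-1 = (e^-1 `^ a^-1) `^ a.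
  by rewrite -powRrM mulVf ?gt_eqF// powRr1// invr_ge0 ltW.
apply: ge0_ler_powR; rewrite ?nnegrE ?powR_ge0 ?(ltW a0) ?(ltW n0)//.
apply: le_trans (ltW (truncnS_gt _)) _.
by rewrite ler_nat.
Qed.

Section PowerMoments.
Context {R : realType} (pi : probability nat R) (b w : nat)
  {d} {T : measurableType d} (P : probability T R)
  (tau : nat -> {RV P >-> nat}) (draw : nat -> {RV P >-> bool})
  (white : nat -> {RV P >-> nat}).
Hypothesis urnP : urn_process pi b w tau draw white.
Hypothesis w0 : (0 < w)%N.

(** The difference x^(k+1) - (rising factorial) is O(x^k), and
x^k is at most x^(k+1) / K when x >= K and at most K^k otherwise.  The choice
K = n^alpha will make this negligible. *)
Lemma power_rising_moment (k C n : nat) (K : R) : 0 < K ->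
  (forall x, (0 < x)%N -> (rising k.+1 x <= x ^ k.+1 + C * x ^ k)%N) ->
  `|Ex P (fun o => (white n o)%:R ^+ k.+1) - Ex P (fun o => (rising k.+1 (white n o))%:R)|
  <= C%:R * (Ex P (fun o => (rising k.+1 (white n o))%:R) / K + K ^+ k).
Proof.
move=> K0 risingC.
have bw (f : nat -> R) : bounded_measurable (fun o => f (white n o)).
  exact: white_bounded_measurable urnP f n.
have bc c : bounded_measurable (fun _ : T => c : R) by exact: bounded_measurable_cst.
have bp := bw (fun x => x%:R ^+ k.+1).
have br := bw (fun x => (rising k.+1 x)%:R).
rewrite distrC -ExB//.
apply: le_trans (le_norm_Ex _ _ (bw (fun x => (rising k.+1 x)%:R - x%:R ^+ k.+1))) _.
have -> : C%:R * (Ex P (fun o => (rising k.+1 (white n o))%:R) / K + K ^+ k) =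
    Ex P (fun o => C%:R * (K^-1 * (rising k.+1 (white n o))%:R + K ^+ k)).
  have brK := bounded_measurableM _ _ (bc K^-1) br.
  rewrite ExZ; last exact: bounded_measurableD.
  by rewrite ExD// ExZ// Ex_cst [_ / K]mulrC.
apply: le_Ex.
- exact: (bw (fun x => `|(rising k.+1 x)%:R - x%:R ^+ k.+1|)).
- exact: (bw (fun x => C%:R * (K^-1 * (rising k.+1 x)%:R + K ^+ k))).
move=> o; have x0 : (0 < white n o)%N by apply: leq_trans w0 (white_ge _ _ _ _ _ _ _ urnP n o).
set x := white n o in x0 *.
have xr : x%:R ^+ k.+1 <= (rising k.+1 x)%:R :> R by rewrite -natrX ler_nat expn_le_rising.
rewrite ger0_norm ?subr_ge0//.
apply: le_trans (_ : C%:R * x%:R ^+ k <= _).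
  by rewrite lerBlDl -!natrX -natrM -natrD ler_nat risingC.
rewrite ler_wpM2l//.
have [Kx|xK] := leP K x%:R.
  apply: le_trans (_ : K^-1 * x%:R ^+ k.+1 <= _).
    rewrite exprS mulrA ler_peMl ?exprn_ge0//.
    by rewrite mulrC ler_pdivlMr// mul1r.
  by apply: ler_wpDr; [rewrite exprn_ge0// ltW|rewrite ler_wpM2l// invr_ge0 ltW].
apply: ler_wpDl; first by rewrite mulr_ge0// invr_ge0 ltW.
by rewrite lerXn2r ?nnegrE// ltW.
Qed.

End PowerMoments.

(** Different steps n come with unrelated probability spaces; only the law of the
number of white balls passes from one space to the other. *)
Lemma expectation_urn_law {R : realType} (pi : probability nat R) (b w n : nat)
    {d} {T : measurableType d} (P : probability T R) (X : {RV P >-> nat})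
    (f : nat -> R) : (forall x, 0 <= f x) ->
  is_urn_law pi b w n (distribution P X) ->
  exists (d' : measure_display) (T' : measurableType d') (P' : probability T' R)
    (tau : nat -> {RV P' >-> nat}) (draw : nat -> {RV P' >-> bool})
    (white : nat -> {RV P' >-> nat}),
    urn_process pi b w tau draw white /\
    'E_P[fun o => f (X o)]%E = (Ex P' (fun o => f (white n o)))%:E.
Proof.
move=> f0 [d' [T' [P' [tau [draw [white [urnP XE]]]]]]].
exists d', T', P', tau, draw, white; split => //.
have mf : measurable_fun [set: nat] (EFin \o f) by move=> _ Y mY; rewrite setTI.
have f0' x : (0 <= (EFin \o f) x)%E by rewrite lee_fin.
rewrite unlock.
transitivity (\int[P]_o ((EFin \o f) \o X) o)%E => //.
rewrite -ge0_integral_distribution//.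
rewrite (eq_measure_integral (distribution P' (white n))) => [|A _ _]; last exact: XE.
rewrite ge0_integral_distribution//.
rewrite -[LHS]fineK//; apply: integrable_fin_num => //.
apply: (@bounded_measurable_integrable _ _ _ P' (fun o => f (white n o))).
exact: white_bounded_measurable urnP f n.
Qed.

Theorem theorem1p2 (R : realType) (b w : nat) (hb : (0 < b)%N) (hw : (0 < w)%N)
    (pi : probability nat R) (hmu : (0 < mean pi)%E)
    (k : nat) (hk : (1 <= k)%N)
    (hyp :
      (exists p : R,
         [/\ 1 < p,
             (\int[pi]_t (t%:R `^ p)%:E < +oo)%E &
             (k%:R%:E < (p / 2 - 1)%:E * (mean pi + 1) - 1)%E]) \/
      (exists eps C : R,
         [/\ 0 < eps, 0 < C &
             \forall n \near \oo,
               ((C * n%:R `^ (- (1 - eps)))%:E <= pi [set t | (n < t)%N])%E])) :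
  exists m : R, 0 < m /\
    forall (d : nat -> measure_display)
      (Omega : forall n, measurableType (d n))
      (P : forall n, probability (Omega n) R)
      (X : forall n, {RV (P n) >-> nat}),
      (forall n, is_urn_law pi b w n (distribution (P n) (X n))) ->
      ('E_(P n)[fun o => (((X n o)%:R / n%:R `^ growth_exponent (mean pi)) ^+ k)%R])%E
        @[n --> \oo] --> m%:E.
Proof.
have [a0 a1 [delta /andP[d0 d1] conc]] := waiting_time_concentrated pi k hmu hyp.
set alpha := growth_exponent (mean pi) in a0 a1 conc *.
have bw0 : (0 < b + w)%N by rewrite addn_gt0 hb.
have [[d [T [P [tau [draw [white urnP]]]]]]|noprocess] := pselect (exists d
    (T : measurableType d) (P : probability T R) (tau : nat -> {RV P >-> nat})
    (draw : nat -> {RV P >-> bool}) (white : nat -> {RV P >-> nat}),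
    urn_process pi b w tau draw white); last first.
  (* Without any urn process no X satisfies the hypothesis. *)
  exists 1; split => // d Omega P X /(_ 0%N)[d' [T' [P' [tau [draw [white [urnP _]]]]]]].
  by exfalso; apply: noprocess; exists d', T', P', tau, draw, white.
pose rho n := Ex P (fun o => (rising k (white n o))%:R : R).
have iid := urn_process_iid _ _ _ _ _ _ _ urnP.
have [C C0 cP] := conc (b + w)%N d T P tau bw0 iid.
have rw0 : (0 : R) < (rising k w)%:R.
  by rewrite ltr0n; apply: prodn_gt0 => i; rewrite addn_gt0 hw.
have gamP n : Ex P (fun o => growth k (b + w) J (tau ^~ o) n) @[J --> \oo] -->
    rho n / (rising k w)%:R.
  have := moment_growth_limit _ _ _ _ _ _ _ urnP hw k n hmu.
  move=> /(cvgMr_tmp (b := (rising k w)%:R^-1)).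
  by under eq_fun do rewrite mulrAC mulfV ?mul1r ?gt_eqF//.
have [m m0 mP] := growth_cvg P tau k (b + w) alpha delta C bw0 a0 a1 d0 d1 C0 cP _ gamP.
exists (m * (rising k w)%:R); split; first by rewrite mulr_gt0.
move=> dn Omega Pn X lawX.
have rhoP : rho n / n%:R `^ (k%:R * alpha) @[n --> \oo] --> m * (rising k w)%:R.
  move: mP => /(cvgMr_tmp (b := (rising k w)%:R)).
  by under eq_fun do rewrite mulrAC divfK ?gt_eqF//.
case: k hk {hyp conc} @rho iid cP rw0 gamP mP rhoP => // k _ rho iid cP rw0 gamP mP rhoP.
have [Ck risingC] := rising_le_expn k.
pose v n : R := fine ('E_(Pn n)[fun o => (((X n o)%:R / n%:R `^ alpha) ^+ k.+1)%R])%E.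
have vP n : 'E_(Pn n)[fun o => (((X n o)%:R / n%:R `^ alpha) ^+ k.+1)%R]%E = (v n)%:E /\
    ((0 < n)%N -> `|v n - rho n / n%:R `^ (k.+1%:R * alpha)| <=
      Ck%:R * (rho n / n%:R `^ (k.+1%:R * alpha) + 1) * n%:R `^ (- alpha)).
  have f0 x : 0 <= (x%:R / n%:R `^ alpha) ^+ k.+1 :> R.
    by rewrite exprn_ge0// divr_ge0// powR_ge0.
  have [d' [T' [P' [tau' [draw' [white' [urnP' EE]]]]]]] :=
    expectation_urn_law pi b w n (Pn n) (X n) (fun x => (x%:R / n%:R `^ alpha) ^+ k.+1) f0 (lawX n).
  rewrite /v EE; split => // n0 /=.
  have n0' : (0 : R) < n%:R by rewrite ltr0n.
  have Na0 x : 0 < n%:R `^ x :> R by rewrite powR_gt0.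
  have powE : (n%:R `^ alpha) ^+ k.+1 = n%:R `^ (k.+1%:R * alpha) :> R.
    by rewrite -powR_mulrn ?powR_ge0// -powRrM mulrC.
  (* Both moments are limits of the same truncated expectations. *)
  have rhoE : Ex P' (fun o => (rising k.+1 (white' n o))%:R) = rho n.
    have L1 := moment_growth_limit _ _ _ _ _ _ _ urnP' hw k.+1 n hmu.
    have L2 := moment_growth_limit _ _ _ _ _ _ _ urnP hw k.+1 n hmu.
    have iid' := urn_process_iid _ _ _ _ _ _ _ urnP'.
    have E J : (rising k.+1 w)%:R * Ex P' (fun o => growth k.+1 (b + w) J (tau' ^~ o) n) =
        (rising k.+1 w)%:R * Ex P (fun o => growth k.+1 (b + w) J (tau ^~ o) n).
      by rewrite (Ex_growth_eq_law pi P' tau' P tau _ _ _ _ iid' iid).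
    rewrite (funext E) in L1.
    exact: (cvg_unique _ L1 L2).
  have -> : Ex P' (fun o => ((white' n o)%:R / n%:R `^ alpha) ^+ k.+1) =
      Ex P' (fun o => (white' n o)%:R ^+ k.+1) / n%:R `^ (k.+1%:R * alpha).
    rewrite mulrC -ExZ; last exact: (white_bounded_measurable _ _ _ _ _ _ _ urnP' (fun x => x%:R ^+ k.+1)).
    by congr Ex; apply/funext => o; rewrite exprMn exprVn powE mulrC.
  rewrite -mulrBl normrM normfV (gtr0_norm (Na0 _)) ler_pdivrMr//.
  (* With K = n^alpha both error terms are of relative order 1 / K. *)
  have := power_rising_moment _ _ _ _ _ _ _ urnP' hw k Ck n _ (Na0 alpha) risingC.
  rewrite rhoE => /le_trans; apply.
  rewrite -!mulrA ler_wpM2l//.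
  have splitE : n%:R `^ (k.+1%:R * alpha) = n%:R `^ alpha * (n%:R `^ alpha) ^+ k :> R.
    by rewrite -powE exprS.
  rewrite powRN splitE.
  set y := n%:R `^ alpha; set z := y ^+ k.
  have y0 : y != 0 by rewrite gt_eqF// Na0.
  have z0 : z != 0 by rewrite expf_neq0.
  rewrite le_eqVlt; apply/orP; left; apply/eqP; field.
  by rewrite y0 z0.
rewrite (_ : (fun n => _) = EFin \o v); last by apply/funext => n; exact: (vP n).1.
apply: cvg_EFin; first by apply: nearW.
have err : Ck%:R * (rho n / n%:R `^ (k.+1%:R * alpha) + 1) * n%:R `^ (- alpha)
    @[n --> \oo] --> (0 : R).
  rewrite -[X in _ --> X](mulr0 (Ck%:R * (m * (rising k.+1 w)%:R + 1))).
  apply: cvgM; last exact: natr_powR_cvg_pinfty.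
  by apply: cvgMl_tmp; apply: cvgD; [exact: rhoP|exact: cvg_cst].
have diff : v n - rho n / n%:R `^ (k.+1%:R * alpha) @[n --> \oo] --> (0 : R).
  apply/norm_cvg0P; apply: (@squeeze_cvgr _ _ _ _ (cst 0)) err; last exact: cvg_cst.
  near=> n; rewrite normr_ge0/=; apply: (vP n).2.
  by near: n; exists 1%N.
have -> : v = (fun n => (v n - rho n / n%:R `^ (k.+1%:R * alpha))
    + rho n / n%:R `^ (k.+1%:R * alpha)).
  by apply/funext => n; rewrite subrK.
by rewrite -[X in _ --> X]add0r; exact: cvgD diff rhoP.
Unshelve. all: by end_near. Qed.
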